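(* Let $\dot\Lambda$ be a Gaussian space-time white noise on $[0,\infty)\times\mathbb{R}$ (spatial dimension $d=1$), let $Y$ be the mild solution to $\partial_t Y=\partial_x^2Y+\dot\Lambda$, $Y(0,\cdot)=0$, and let $Y_0(t)=Y(t,0)$. Then the following law of the iterated logarithm holds: $$\limsup_{t\to\infty}\frac{Y_0(t)}{(2t/\pi)^{1/4}\sqrt{\log\log t}}=-\liminf_{t\to\infty}\frac{Y_0(t)}{(2t/\pi)^{1/4}\sqrt{\log\log t}}=1\quad\text{almost surely.}$$ In particular, $\lim_{t\to\infty}Y_0(t)/t=0$ almost surely.
   Context: The heat kernel is $g(t,x)=(4\pi t)^{-1/2}e^{-x^2/(4t)}$ for $t>0$, $x\in\mathbb{R}$. The mild solution is $Y(t,x)=\int_0^t\int_{\mathbb{R}}g(t-s,x-y)\,\Lambda(ds,dy)$, a Wiener integral with respect to the Gaussian white noise $\Lambda$ (a centered Gaussian random measure with $\mathbb{E}[\Lambda(A)\Lambda(B)]=\mathrm{Leb}(A\cap B)$). Thus $Y_0(t)=\int_0^t\int_{\mathbb{R}}g(t-s,y)\,\Lambda(ds,dy)$ is a centered Gaussian process; it is considered in its continuous version. *)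

(* Defs.v *)
From HB Require Import structures.
From mathcomp Require Import all_boot all_order all_algebra.
From mathcomp Require Import all_classical all_reals all_analysis.

Set Implicit Arguments.
Unset Strict Implicit.
Unset Printing Implicit Defensive.

Import Order.TTheory GRing.Theory Num.Theory.
Import numFieldNormedType.Exports.
Import HBSimple.

Local Open Scope classical_set_scope.
Local Open Scope ring_scope.

Section white_noise.
Context {R : realType} d {Omega : measurableType d} (P : probability Omega R).

(* [normal_prob m 0] is not the point mass at m, so the degenerate Gaussian law
   needs its own case. *)
Definition centered_gaussian (X : {RV P >-> R}) :=
  exists2 s : R, 0 <= s &
    forall B : set R, measurable B ->
      distribution P X B =
        (if s == 0 then \d_(0 : R) B else normal_prob 0 s B).

Definition space_time := (measurableTypeR R * measurableTypeR R)%type.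

Definition space_time_leb : {measure set space_time -> \bar R} :=
  (@lebesgue_measure R \x @lebesgue_measure R)%E.

Definition half_plane : set space_time := `[0, +oo[ `*` [set: R].

Definition finite_area (A : set space_time) :=
  [/\ measurable A, A `<=` half_plane & (space_time_leb A < +oo)%E].

(* Only the values of [L] on sets of finite area are meaningful.  As usual for
   random measures, countable additivity is in the L^2 sense, not pathwise. *)
Record white_noise (L : set space_time -> {RV P >-> R}) : Prop := {
  white_noise_gaussian : forall (n : nat) (c : 'I_n -> R)
      (A : 'I_n -> set space_time), (forall i, finite_area (A i)) ->
    centered_gaussian (\sum_(i < n) c i *: L (A i));
  white_noise_cov : forall A B, finite_area A -> finite_area B ->
    ('E_P[(fun w => L A w * L B w)%R] = space_time_leb (A `&` B))%E;
  white_noise_additive : forall A : (set space_time)^nat,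
    (forall k, measurable (A k)) -> trivIset [set: nat] A ->
    finite_area (\bigcup_k A k) ->
    'E_P[(fun w => (\sum_(k < n) L (A k) w - L (\bigcup_k A k) w) ^+ 2)%R]%E
      @[n --> \oo] --> 0%E }.

(* Elementary integral over A of a simple function; the value r = 0, whose
   level set may have infinite area, contributes 0. *)
Definition elementary_integral (L : set space_time -> {RV P >-> R})
    (A : set space_time) (h : {sfun space_time >-> R}) : Omega -> R :=
  fun w => \sum_(r \in range h) r * L (A `&` h @^-1` [set r]) w.

(* X is a version of the Wiener integral of f over A: an L^2(P)-limit of
   elementary integrals of simple functions converging to f in L^2(A). *)
Definition wiener_integral (L : set space_time -> {RV P >-> R})
    (A : set space_time) (f : space_time -> R) (X : {RV P >-> R}) :=
  exists h : nat -> {sfun space_time >-> R},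
    [/\ forall n, (\int[space_time_leb]_(z in A) ((h n z) ^+ 2)%:E < +oo)%E,
        (\int[space_time_leb]_(z in A) ((h n z - f z) ^+ 2)%:E)%E
          @[n --> \oo] --> 0%E &
        'E_P[(fun w => (elementary_integral L A (h n) w - X w) ^+ 2)%R]%E
          @[n --> \oo] --> 0%E].

Definition heat_kernel (t x : R) : R :=
  (4 * pi * t) `^ (- 2^-1) * expR (- (x ^+ 2 / (4 * t))).

Definition mild_solution (L : set space_time -> {RV P >-> R})
    (Y : R -> R -> {RV P >-> R}) :=
  forall t x, 0 <= t ->
    wiener_integral L (`[0, t[ `*` [set: R])
      (fun z => heat_kernel (t - z.1) (x - z.2)) (Y t x).

Definition continuous_version (Z Z' : R -> {RV P >-> R}) :=
  (forall t, 0 <= t -> {ae P, forall w, Z' t w = Z t w}) /\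
  {ae P, forall w, {within `[0, +oo[, continuous (fun t => Z' t w)}}.

End white_noise.

(* Main.v *)
Require Import Defs.
From HB Require Import structures.
From mathcomp Require Import all_boot all_order all_algebra.
From mathcomp Require Import all_classical all_reals all_analysis.
From mathcomp Require Import measurable_realfun.
From mathcomp Require Import ring lra.

Import Order.TTheory GRing.Theory Num.Theory.
Import numFieldNormedType.Exports.

Local Open Scope classical_set_scope.
Local Open Scope ring_scope.

(** [Y0] is a centered Gaussian process with covariance
    [(sqrt (s + t) - sqrt (t - s)) / sqrt (4 pi)] for [s <= t]; the
    argument uses its law only through the exponential moments of
    [a Y0(s) + b Y0(t)].

    Upper bound: along the geometric times [th ^ k] this is Borel-Cantelli with
    the Gaussian tail bound.  Between two such times, dyadic chaining controls
    the increments, whose variance is at most [2 sqrt (t - s) / sqrt (4 pi)], so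
    that the oscillation is negligible when [th] is close to 1.

    Lower bound: the normalised values [G_k] of [Y0] at the times [n ^ k.+1],
    [k < n], have pairwise correlations at most [sqrt (2 / n)].  Instead of
    comparing them with independent variables, apply the second moment method to
    the sum over [k] of the weights [expR (beta G_k - beta ^ 2 / 2)], of mean 1,
    restricted to [a < G_k <= b]: tilting moves the mean of [G_k] to [beta], in
    the middle of this window, so that the restriction costs almost nothing, and
    it keeps the diagonal terms of the second moment small.  Hence some [G_k]
    exceeds [a] with probability tending to 1 as [n] grows, for
    [a = (1 - 3 e) sqrt (2 ln n)], and [ln (ln (n ^ k.+1))] is equivalent to
    [ln n]. *)

(** * Gaussian moments *)

(** The values of the process at different times are correlated, so the converse Borel-Cantelli
    lemma is out of reach, and the probability that all the [G_k] stay below [a] is only bounded by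
    a multiple of [1 / ln n], which is not summable over [n].

    Exponential moments of pairs are enough because they pass to the L^2 limits defining the Wiener
    integral, they yield the tails through Chernoff's inequality, and tilting by [expR (beta G_k)]
    merely shifts their parameter. The off-diagonal second moments are [expR (beta ^ 2 rho)] with
    [rho] the correlation. As [beta ^ 2 <= 2 ln n], they tend to 1 because [rho] decays like a power
    of [n]; this is why the ratio of consecutive times grows with [n] in the lower bound, whereas it
    is a constant [th] in the upper bound. *)

Lemma integral_normal_prob (R : realType) (m s : R) (f : R -> \bar R) :
  (forall x, 0 <= f x)%E -> measurable_fun [set: R] f ->
  (\int[normal_prob m s]_x f x =
   \int[lebesgue_measure]_x (f x * (normal_pdf m s x)%:E))%E.
Proof.
move=> f0 mf.
have dom := normal_prob_dominates m s.
rewrite -(Radon_Nikodym_SigmaFinite.change_of_variables dom)//=.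
have mpdf : measurable_fun [set: R] (fun x => (normal_pdf m s x)%:E).
  by apply/measurable_EFinP; exact: measurable_normal_pdf.
have mg : measurable_fun [set: R]
    (Radon_Nikodym_SigmaFinite.f (normal_prob m s) lebesgue_measure).
  exact: measurable_int (Radon_Nikodym_SigmaFinite.f_integrable dom).
apply: ae_eq_integral => //; [exact: emeasurable_funM..|].
apply: ae_eqe_mul2l; apply: integral_ae_eq => //.
- exact: Radon_Nikodym_SigmaFinite.f_integrable.
- by move=> A _ mA; rewrite -Radon_Nikodym_SigmaFinite.f_integral.
Qed.

(** Completing the square turns the weight times the centred density into a constant times the
    density of mean [a * s ^+ 2]. *)
Lemma integral_expR_normal_prob (R : realType) (s a : R) : s != 0 ->
  (\int[normal_prob 0 s]_x (expR (a * x))%:E = (expR (a ^+ 2 * s ^+ 2 / 2))%:E)%E.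
Proof.
move=> s0; rewrite integral_normal_prob//; last first.
  by apply/measurable_EFinP; apply: measurableT_comp => //; exact: measurable_funM.
under eq_integral => x _.
  rewrite -EFinM [X in X%:E](_ : _ = expR (a ^+ 2 * s ^+ 2 / 2) *
    normal_pdf (a * s ^+ 2) s x); last first.
    rewrite !normal_pdfE// mulrCA [RHS]mulrCA; congr (_ * _).
    rewrite /normal_fun -!expRD; congr expR.
    by field.
  rewrite EFinM; over.
rewrite ge0_integralZl_EFin ?expR_ge0//; last 2 first.
- by move=> x _; rewrite lee_fin normal_pdf_ge0.
- by apply/measurable_EFinP; exact: measurable_normal_pdf.
by rewrite integral_normal_pdf mule1.
Qed.

(** The weight replaces [s] by [s'] in the exponent of the density, and the ratio of the normalising
    constants remains. Parametrising by [s'] covers both signs of the coefficient of [x ^+ 2]. *)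
Lemma integral_expR_sqr_normal_prob (R : realType) (s s' : R) :
  0 < s -> 0 < s' ->
  (\int[normal_prob 0 s]_x (expR (- ((s' ^- 2 - s ^- 2) / 2 * x ^+ 2)))%:E =
   (s' / s)%:E)%E.
Proof.
move=> s0 s'0; rewrite integral_normal_prob//; last first.
  apply/measurable_EFinP; apply: measurableT_comp => //.
  by apply: measurableT_comp => //; exact: measurable_funM.
have peakE (r : R) : 0 < r -> normal_peak r = r^-1 * (Num.sqrt (pi *+ 2))^-1.
  move=> r0; rewrite /normal_peak -mulrnAr sqrtrM ?sqr_ge0// sqrtr_sqr.
  by rewrite gtr0_norm// invfM.
under eq_integral => x _.
  rewrite -EFinM [X in X%:E](_ : _ = (s' / s) * normal_pdf 0 s' x); last first.
    rewrite !normal_pdfE ?gt_eqF// !peakE// /normal_fun.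
    rewrite mulrCA -expRD [X in expR X](_ : _ = - (x - 0) ^+ 2 / (s' ^+ 2 *+ 2)).
      rewrite !mulrA [s' / s / s']mulrAC divff ?gt_eqF// div1r//.
    by field; rewrite !gt_eqF.
  rewrite EFinM; over.
rewrite ge0_integralZl_EFin ?divr_ge0 ?ltW//; last 2 first.
- by move=> x _; rewrite lee_fin normal_pdf_ge0.
- by apply/measurable_EFinP; exact: measurable_normal_pdf.
by rewrite integral_normal_pdf mule1.
Qed.

(* Squeezes the second moment between difference quotients at 0 of the
   exponential moments of [x ^ 2], using [1 + u <= expR u]. *)
Lemma integral_sqr_normal_prob (R : realType) (s : R) : 0 < s ->
  (\int[normal_prob 0 s]_x (x ^+ 2)%:E = (s ^+ 2)%:E)%E.
Proof.
move=> s0.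
have s2 : 0 < s ^+ 2 by rewrite exprn_gt0.
have msq : measurable_fun [set: R] (fun x : R => (x ^+ 2)%:E).
  by apply/measurable_EFinP.
have mcsq (c : R) : measurable_fun [set: R] (fun x : R => (c * x ^+ 2)%:E).
  by apply/measurable_EFinP; exact: measurable_funM.
have mex (c : R) : measurable_fun [set: R] (fun x : R => (expR (- (c * x ^+ 2)))%:E).
  apply/measurable_EFinP; apply: measurableT_comp => //.
  by apply: measurableT_comp => //; exact: measurable_funM.
have Z (c : R) : 0 < c -> (\int[normal_prob 0 s]_x (c * x ^+ 2)%:E =
    c%:E * \int[normal_prob 0 s]_x (x ^+ 2)%:E)%E.
  move=> c0; under eq_integral do rewrite EFinM.
  by rewrite ge0_integralZl_EFin ?ltW// => x _; rewrite lee_fin sqr_ge0.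
have I1 : (\int[normal_prob 0 s]_x 1%:E = 1)%E.
  by rewrite integral_cst// mul1e; exact: probability_setT.
have up (h : R) : 0 < h ->
    (\int[normal_prob 0 s]_x (x ^+ 2)%:E <= (s ^+ 2 * (1 + 2 * h))%:E)%E.
  move=> h0; have h1 : 0 < 1 + h by rewrite addr_gt0.
  (* With [s' = s * (1 + h)] the coefficient [c] is negative and the exponential moment is exactly
     [1 + h]. *)
  pose c := ((s * (1 + h)) ^- 2 - s ^- 2) / 2.
  have cE : - c * s ^+ 2 = (2 * h + h ^+ 2) / (1 + h) ^+ 2 / 2.
    by rewrite /c; field; rewrite !gt_eqF.
  have c0 : 0 < - c.
    by rewrite -(pmulr_lgt0 _ s2) cE !divr_gt0// ?exprn_gt0// addr_gt0// ?exprn_gt0// mulr_gt0.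
  have : (1 + (- c)%:E * \int[normal_prob 0 s]_x (x ^+ 2)%:E
         <= \int[normal_prob 0 s]_x (expR (- (c * x ^+ 2)))%:E)%E.
    rewrite -Z// -{1}I1 -ge0_integralD//; last 2 first.
    - by move=> x _; rewrite lee_fin mulr_ge0 ?sqr_ge0// ltW.
    - exact: mcsq.
    apply: ge0_le_integral => //.
    - by move=> x _; rewrite lee_fin addr_ge0// mulr_ge0 ?sqr_ge0// ltW.
    - by apply: emeasurable_funD => //; exact: mcsq.
    - exact: mex.
    - by move=> x _; rewrite -EFinD lee_fin mulNr expR_ge1Dx.
  rewrite integral_expR_sqr_normal_prob ?mulr_gt0//.
  have : (0 <= \int[normal_prob 0 s]_x (x ^+ 2)%:E)%E.
    by apply: integral_ge0 => x _; rewrite lee_fin sqr_ge0.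
  case: (\int[normal_prob 0 s]_x (x ^+ 2)%:E)%E => [m| |] // m0; last first.
    by rewrite mulry gtr0_sg// mul1e addey.
  rewrite -EFinM -EFinD !lee_fin mulrAC divff ?gt_eqF// mul1r lerD2l => H.
  rewrite -(ler_pM2l c0) (le_trans H)// mulrA cE.
  rewrite mulrAC ler_pdivlMr// mulrAC ler_pdivlMr ?exprn_gt0// -subr_ge0.
  rewrite [leRHS](_ : _ = h ^+ 2) ?sqr_ge0//; ring.
have lo (h : R) : 0 < h < 1 ->
    ((s ^+ 2 * (1 - 2 * h))%:E <= \int[normal_prob 0 s]_x (x ^+ 2)%:E)%E.
  move=> /andP[h0 h1]; have h1' : 0 < 1 - h by rewrite subr_gt0.
  pose c := ((s * (1 - h)) ^- 2 - s ^- 2) / 2.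
  have cE : c * s ^+ 2 = (2 * h - h ^+ 2) / (1 - h) ^+ 2 / 2.
    by rewrite /c; field; rewrite !gt_eqF.
  have c0 : 0 < c.
    rewrite -(pmulr_lgt0 _ s2) cE !divr_gt0// ?exprn_gt0//.
    by rewrite subr_gt0 expr2 ltr_pM2r// (lt_trans h1)// ltr1n.
  have : (1 <= \int[normal_prob 0 s]_x (expR (- (c * x ^+ 2)))%:E +
       (c%:E * \int[normal_prob 0 s]_x (x ^+ 2)%:E))%E.
    rewrite -Z// -{1}I1 -ge0_integralD//; last 3 first.
    - exact: mex.
    - by move=> x _; rewrite lee_fin mulr_ge0 ?sqr_ge0// ltW.
    - exact: mcsq.
    apply: ge0_le_integral => //.
    - by apply: emeasurable_funD; [exact: mex|exact: mcsq].
    - by move=> x _; rewrite -EFinD lee_fin -lerBlDr expR_ge1Dx.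
  rewrite integral_expR_sqr_normal_prob ?mulr_gt0//.
  case: (\int[normal_prob 0 s]_x (x ^+ 2)%:E)%E => [m| |] //; last 2 first.
  - by rewrite leey.
  - by rewrite mulrNy gtr0_sg// mul1e.
  rewrite -EFinM -EFinD !lee_fin mulrAC divff ?gt_eqF// mul1r => H.
  have {}H : h <= c * m by rewrite -(lerD2l (1 - h)) subrK.
  rewrite -(ler_pM2l c0) (le_trans _ H)// mulrA cE.
  rewrite mulrAC ler_pdivrMr// mulrAC ler_pdivrMr ?exprn_gt0// -subr_ge0.
  rewrite [leRHS](_ : _ = h ^+ 2) ?sqr_ge0//; ring.
apply/eqP; rewrite eq_le; apply/andP; split.
- apply/lee_addgt0Pr => e e0; have := up (e / (2 * s ^+ 2)).
  rewrite divr_gt0 ?mulr_gt0// => /(_ isT)/le_trans; apply.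
  rewrite -EFinD lee_fin le_eqVlt; apply/orP; left; apply/eqP; field.
  by rewrite gt_eqF.
- apply/lee_subgt0Pr => e e0.
  pose h := Num.min (e / (2 * s ^+ 2)) (2^-1).
  have h0 : 0 < h < 1.
    rewrite /h lt_min divr_gt0 ?mulr_gt0//= invr_gt0 ltr0n/= gt_min; apply/orP; right.
    by rewrite invf_lt1 ?ltr1n.
  apply: le_trans (lo _ h0); rewrite -EFinB lee_fin mulrBr mulr1 lerD2l lerN2.
  rewrite mulrA -ler_pdivlMl ?mulr_gt0// mulrC [s ^+ 2 * 2]mulrC.
  by rewrite /h ge_min lexx.
Qed.

(** Expressing the exponential moments through the second moment [v] lets convergence of variances
    carry over to them; [v = 0] accounts for the point mass. *)
Lemma centered_gaussian_moments (R : realType) d (T : measurableType d)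
    (P : probability T R) (X : {RV P >-> R}) : centered_gaussian X ->
  exists v : R, ('E_P[fun w => (X w ^+ 2)%R] = v%:E)%E /\
    forall a : R, ('E_P[fun w => expR (a * X w)] = (expR (a ^+ 2 * v / 2))%:E)%E.
Proof.
case=> s s0 Xs; exists (s ^+ 2).
have law (f : R -> R) : measurable_fun [set: R] f -> (forall x, 0 <= f x) ->
    ('E_P[fun w => f (X w)] =
     if (s == 0)%R then (f 0%R)%:E else \int[normal_prob 0 s]_x (f x)%:E)%E.
  move=> mf f0; rewrite unlock.
  have mEf : measurable_fun [set: R] (fun x => (f x)%:E) by exact/measurable_EFinP.
  have mX : measurable_fun [set: T] (X : T -> measurableTypeR R) by exact: (measurable_funPT X).
  pose X' : {mfun T >-> measurableTypeR R} := @mfun_Sub _ _ T (measurableTypeR R) X (mem_set mX).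
  rewrite -(@ge0_integral_distribution _ _ _ _ _ P X' (fun x => (f x)%:E))//.
  case: ifPn => [|] s00.
    rewrite (eq_measure_integral (\d_(0 : measurableTypeR R)))//=.
      by rewrite integral_dirac// diracT mul1e.
    by move=> A mA _; rewrite -[LHS]/(distribution P X A) Xs// s00.
  apply: (eq_measure_integral (normal_prob 0 s)) => A mA _.
  by rewrite -[LHS]/(distribution P X A) Xs// (negPf s00).
split=> [|a].
- rewrite (law (fun x => x ^+ 2))// => [|x]; last exact: sqr_ge0.
  have [->|sn0] := eqVneq s 0; first by rewrite !expr0n.
  by rewrite integral_sqr_normal_prob// lt_def sn0.
- rewrite (law (fun x => expR (a * x))) => [|/=|x]; last exact: expR_ge0.
    have [->|sn0] := eqVneq s 0; last by rewrite integral_expR_normal_prob.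
    by rewrite mulr0 expr0n mulr0 mul0r.
  by apply: measurableT_comp => //; exact: measurable_funM.
Qed.

(** Below height [M] the exponential is Lipschitz with constant [expR M]; the increment
    [u = expR M * (x - y)] is then traded for a squared distance by [u <= e + u ^+ 2 / e]. *)
Lemma expR_minr_lip (R : realType) (M e x y : R) : 0 < e ->
  expR (Num.min x M) <= expR (Num.min y M) + e + expR (2 * M) / e * (x - y) ^+ 2.
Proof.
move=> e0.
have nn : 0 <= expR (2 * M) / e * (x - y) ^+ 2.
  by rewrite mulr_ge0 ?sqr_ge0// divr_ge0 ?expR_ge0// ltW.
have [xy|yx] := leP x y.
  rewrite (@le_trans _ _ (expR (Num.min y M)))//.
    by rewrite ler_expR le_min !ge_min xy lexx orbT.
  by rewrite -addrA lerDl addr_ge0// ltW.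
have lip : expR (Num.min x M) <= expR (Num.min y M) + expR M * (x - y).
  rewrite -lerBlDl.
  have -> : expR (Num.min x M) - expR (Num.min y M) =
      expR (Num.min x M) * (1 - expR (Num.min y M - Num.min x M)).
    by rewrite mulrBr mulr1 -expRD addrCA subrr addr0.
  apply: ler_pM; rewrite ?expR_ge0//.
  - by rewrite subr_ge0 -expR0 ler_expR subr_le0 le_min !ge_min lexx (ltW yx) orbT.
  - by rewrite ler_expR ge_min lexx orbT.
  - rewrite lerBlDr -lerBlDl; apply: le_trans (expR_ge1Dx _).
    rewrite lerD2l lerNl opprB.
    by rewrite /Num.min; case: ltP => ?; case: ltP => ?; lra.
apply: (le_trans lip); rewrite -addrA lerD2l.
set u := expR M * (x - y).
have -> : expR (2 * M) / e * (x - y) ^+ 2 = u ^+ 2 / e.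
  rewrite /u exprMn -(expRM_natl 2) [RHS]mulrAC//.
have u0 : 0 <= u by rewrite mulr_ge0 ?expR_ge0// subr_ge0 ltW.
rewrite -(ler_pM2r e0) mulrDl divfK ?gt_eqF//.
nra.
Qed.

(* Truncating [expR] at height [M] makes it Lipschitz, hence continuous along
   L^2 limits; the second exponential moments of the [Z n] make the truncation
   error at most of order [expR (- M)], uniformly in [n]. *)
Lemma expectation_expR_limit (R : realType) d (T : measurableType d)
    (P : probability T R) (Z : nat -> {RV P >-> R}) (X : {RV P >-> R}) (v : R) :
  (forall n, centered_gaussian (Z n)) ->
  ('E_P[fun w => (Z n w - X w) ^+ 2]%R @[n --> \oo] --> 0)%E ->
  ('E_P[fun w => Z n w ^+ 2]%R @[n --> \oo] --> v%:E)%E ->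
  ('E_P[fun w => expR (X w)] = (expR (v / 2))%:E)%E.
Proof.
move=> gZ dist0 cvgv.
have /choice[u uE] : forall n, exists u : R, ('E_P[fun w => (Z n w ^+ 2)%R] = u%:E)%E /\
    forall a : R, ('E_P[fun w => expR (a * Z n w)] = (expR (a ^+ 2 * u / 2))%:E)%E.
  by move=> n; exact: centered_gaussian_moments.
have uv : u n @[n --> \oo] --> v.
  have := cvgv; under eq_fun do rewrite (uE _).1.
  by move/fine_cvgP => -[].
have ucvg (a : R) : (expR (a ^+ 2 * u n / 2))%:E @[n --> \oo] --> (expR (a ^+ 2 * v / 2))%:E.
  apply: cvg_EFin; first exact: nearW.
  apply: (cvg_comp _ expR); last exact: continuous_expR.
  by apply: cvgMr_tmp; apply: cvgMl_tmp.
pose phi (M : R) (Y : T -> R) := fun w => (expR (Num.min (Y w) M))%:E.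
have mmin M (Y : {RV P >-> R}) : measurable_fun [set: T] (phi M Y).
  apply/measurable_EFinP; apply: measurableT_comp => //.
  exact: measurable_minr.
have phi0 M Y w : (0 <= phi M Y w)%E by rewrite lee_fin expR_ge0.
have mexp (a : R) (Y : {RV P >-> R}) : measurable_fun [set: T] (fun w => (expR (a * Y w))%:E).
  by apply/measurable_EFinP; apply: measurableT_comp => //; exact: measurable_funM.
have mdist n : measurable_fun [set: T] (fun w => ((Z n w - X w) ^+ 2)%:E).
  by apply/measurable_EFinP; apply: measurable_funX; exact: measurable_funB.
pose D n := ('E_P[(fun w => (Z n w - X w) ^+ 2)%R])%E.
have linD (M e : R) (f : T -> R) n : 0 < e -> measurable_fun setT f -> (forall w, 0 <= f w) ->
    (\int[P]_w (f w + e + expR (2 * M) / e * (Z n w - X w) ^+ 2)%:E =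
     \int[P]_w (f w)%:E + e%:E + (expR (2 * M) / e)%:E * D n)%E.
  move=> e0 mf f0; have c0 : 0 <= expR (2 * M) / e by rewrite divr_ge0 ?expR_ge0// ltW.
  have mEf : measurable_fun [set: T] (fun w => (f w)%:E) by exact/measurable_EFinP.
  under eq_integral do rewrite !EFinD EFinM.
  rewrite ge0_integralD//; last 4 first.
  - by move=> w _; rewrite -EFinD lee_fin addr_ge0// ltW.
  - exact: emeasurable_funD.
  - by move=> w _; rewrite mule_ge0// lee_fin sqr_ge0.
  - exact: measurable_funeM.
  rewrite ge0_integralD//; last 2 first.
  - by move=> w _; rewrite lee_fin.
  - by move=> w _; rewrite lee_fin ltW.
  rewrite ge0_integralZl_EFin//; last by move=> w _; rewrite lee_fin sqr_ge0.
  by rewrite integral_cst//= (@probability_setT _ _ _ P) mule1 /D unlock.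
have mexpr (a : R) (Y : {RV P >-> R}) : measurable_fun [set: T] (fun w => expR (a * Y w)).
  by apply/measurable_EFinP; exact: mexp.
have mphir M (Y : {RV P >-> R}) : measurable_fun [set: T] (fun w => expR (Num.min (Y w) M)).
  by apply/measurable_EFinP; exact: mmin.
have mlin (M e : R) (f : T -> R) n : measurable_fun setT f ->
   measurable_fun [set: T] (fun w => (f w + e + expR (2 * M) / e * (Z n w - X w) ^+ 2)%:E).
  move=> mf; apply/measurable_EFinP; apply: measurable_funD; first exact: measurable_funD.
  by apply: measurable_funM => //; apply: measurable_funX; exact: measurable_funB.
have up M e n : 0 < e -> (\int[P]_w phi M X w <=
    (expR (1 ^+ 2 * u n / 2))%:E + e%:E + (expR (2 * M) / e)%:E * D n)%E.
  move=> e0; rewrite -(uE n).2 unlock -linD//.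
  apply: ge0_le_integral => //.
  - by apply: mlin; exact: mexpr.
  - move=> w _; rewrite lee_fin.
    rewrite (le_trans (expR_minr_lip _ M _ (X w) (Z n w) e0))// -(sqrrN (_ - _)) opprB lerD2r.
    by rewrite lerD2r ler_expR mul1r ge_min lexx.
have lo M e n : 0 < e -> ((expR (1 ^+ 2 * u n / 2))%:E <= 
     \int[P]_w phi M X w + e%:E + (expR (2 * M) / e)%:E * D n + 
     (expR (- M))%:E * (expR (2 ^+ 2 * u n / 2))%:E)%E.
  move=> e0; have u1 := (uE n).2 1; have u2 := (uE n).2 2.
  rewrite unlock in u1, u2; rewrite -u1 -u2.
  rewrite -ge0_integralZl_EFin ?expR_ge0//.
  rewrite -(linD M e (fun w => expR (Num.min (X w) M)) n e0 (mphir M X) (fun w => expR_ge0 _)).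
  rewrite -ge0_integralD//; last 3 first.
  - move=> w _; rewrite lee_fin !addr_ge0 ?expR_ge0 ?(ltW e0)//.
    by rewrite mulr_ge0 ?sqr_ge0// divr_ge0 ?expR_ge0// ltW.
  - by apply: mlin.
  - by apply: measurable_funeM; exact: mexp.
  apply: ge0_le_integral => //.
  - by apply: emeasurable_funD; [exact: mlin|apply: measurable_funeM; exact: mexp].
  - move=> w _; rewrite -EFinM -EFinD lee_fin.
    apply: (@le_trans _ _ (expR (Num.min (Z n w) M) + expR (- M) * expR (2 * Z n w))); last first.
      by rewrite lerD2r expR_minr_lip.
    (* Above the truncation height, [expR z <= expR (2 * z - M)]. *)
    rewrite mul1r -expRD; have [zM|Mz] := leP (Z n w) M.
      by rewrite lerDl expR_ge0.
    by rewrite ler_wpDl ?expR_ge0// ler_expR; lra.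
have cD M (e : R) : 0 < e -> ((expR (2 * M) / e)%:E * D n)%E @[n --> \oo] --> 0%E.
  by move=> e0; rewrite -[0%E](mule0 (expR (2 * M) / e)%:E); exact: cvgeZl.
have phiX (M : R) : (\int[P]_w phi M X w <= (expR (v / 2))%:E)%E.
  apply/lee_addgt0Pr => e e0.
  apply: (@cvge_ge _ \oo _ _ (fun n => (expR (1 ^+ 2 * u n / 2))%:E + e%:E + (expR (2 * M) / e)%:E * D n)%E).
    by apply: nearW => n; exact: up.
  rewrite -[X in _ --> X]adde0; apply: cvgeD => //; last exact: cD.
  apply: cvgeD => //; last exact: cvg_cst.
  have := ucvg 1; rewrite {2}expr1n mul1r; exact.
have lim_lo (M e : R) : 0 < e -> ((expR (v / 2))%:E <=
    \int[P]_w phi M X w + e%:E + (expR (- M) * expR (2 ^+ 2 * v / 2))%:E)%E.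
  move=> e0; apply: (@lee_cvg_to _ \oo _ _ (fun n => (expR (1 ^+ 2 * u n / 2))%:E)
    (fun n => \int[P]_w phi M X w + e%:E + (expR (2 * M) / e)%:E * D n +
     (expR (- M))%:E * (expR (2 ^+ 2 * u n / 2))%:E)%E).
  - by have := ucvg 1; rewrite {2}expr1n mul1r; exact.
  - apply: cvgeD; first by rewrite fin_num_adde_defl.
      rewrite -[X in _ --> X]adde0; apply: cvgeD; last exact: cD.
        by rewrite fin_num_adde_defl.
      exact: cvg_cst.
    by rewrite EFinM; apply: cvgeZl.
  - by apply: nearW => n; exact: lo.
(* At each point the truncations are eventually equal to [expR (X w)], and they increase with the
   height, so monotone convergence applies. *)
have XE : (\int[P]_w (expR (X w))%:E = \int[P]_w limn (fun k : nat => phi k%:R X w))%E.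
  apply: eq_integral => w _; apply/esym/lim_near_cst => //.
  exists (Num.truncn `|X w|).+1 => // k /= kX.
  congr (expR _)%:E; apply/min_idPl.
  rewrite (le_trans (ler_norm _))// (le_trans (ltW (truncnS_gt _)))//.
  by rewrite ler_nat.
rewrite unlock; apply/eqP; rewrite eq_le; apply/andP; split.
- rewrite XE; apply: (@cvge_le _ \oo); last first.
    apply: cvg_monotone_convergence => //.
    move=> w _ m n mn; rewrite lee_fin ler_expR le_min !ge_min lexx/=.
    by rewrite ler_nat mn orbT.
  by apply: nearW.
- apply/lee_addgt0Pr => e e0.
  pose K := expR (2 ^+ 2 * v / 2).
  have e2 : 0 < e / 2 by rewrite divr_gt0.
  (* At this height the truncation error [expR (- M) * K] equals [e / 2]. *)
  apply: le_trans (lim_lo (ln (2 * K / e)) _ e2) _.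
  rewrite -addeA leeD//.
    apply: ge0_le_integral => //.
    - by apply/measurable_EFinP; exact: measurableT_comp.
    - by move=> w _; rewrite lee_fin ler_expR ge_min lexx.
  rewrite -EFinD lee_fin expRN lnK ?posrE; last first.
    by rewrite divr_gt0// mulr_gt0 ?expR_gt0.
  rewrite -/K le_eqVlt; apply/orP; left; apply/eqP; field.
  by rewrite !gt_eqF// ?expR_gt0.
Qed.

(** * Exponential moments of Wiener integrals *)

Lemma mfun_linE (R : realType) d (T : measurableType d) (n : nat)
    (c : 'I_n -> R) (X : 'I_n -> {mfun T >-> R}) (w : T) :
  (\sum_(i < n) c i *: X i) w = \sum_(i < n) c i * X i w.
Proof. by rewrite mfun_sum. Qed.

(** Two weighted Young inequalities do the work of the triangle inequality:
    [x^2 <= (1 + e) y^2 + (1 + 1/e) (x - y)^2] and [(1 - e) y^2 <= x^2 + (x - y)^2 / e]. They can be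
    integrated in the extended reals before [f n] is known to be square integrable. *)
Lemma cvg_integral_sqr (R : realType) d (T : measurableType d)
    (mu : {measure set T -> \bar R}) (f : nat -> T -> R) (g : T -> R) (v : R) :
  (forall n, measurable_fun setT (f n)) -> measurable_fun setT g ->
  (\int[mu]_z ((g z) ^+ 2)%:E = v%:E)%E ->
  (\int[mu]_z ((f n z - g z) ^+ 2)%:E)%E @[n --> \oo] --> 0%E ->
  (\int[mu]_z ((f n z) ^+ 2)%:E)%E @[n --> \oo] --> v%:E.
Proof.
move=> mf mg gv.
pose D n := (\int[mu]_z ((f n z - g z) ^+ 2)%:E)%E.
pose U n := (\int[mu]_z ((f n z) ^+ 2)%:E)%E.
move=> D0; change (D n @[n --> \oo] --> 0%E) in D0; change (U n @[n --> \oo] --> v%:E).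
have mD n : measurable_fun [set: T] (fun z => ((f n z - g z) ^+ 2)%:E).
  by apply/measurable_EFinP; apply: measurable_funX; exact: measurable_funB.
have mU n : measurable_fun [set: T] (fun z => ((f n z) ^+ 2)%:E).
  by apply/measurable_EFinP; exact: measurable_funX.
have mg2 : measurable_fun [set: T] (fun z => ((g z) ^+ 2)%:E).
  by apply/measurable_EFinP; exact: measurable_funX.
have sq0 (h : T -> R) z : (0 <= ((h z) ^+ 2)%:E)%E by rewrite lee_fin sqr_ge0.
have sqD n z : (0 <= ((f n z - g z) ^+ 2)%:E)%E by rewrite lee_fin sqr_ge0.
have v0 : 0 <= v by rewrite -lee_fin -gv integral_ge0.
have comb (a b : R) (F G : T -> \bar R) : 0 <= a -> 0 <= b ->
    measurable_fun setT F -> measurable_fun setT G ->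
    (forall z, 0 <= F z)%E -> (forall z, 0 <= G z)%E ->
    (\int[mu]_z (a%:E * F z + b%:E * G z) = a%:E * \int[mu]_z F z + b%:E * \int[mu]_z G z)%E.
  move=> a0 b0 mF mG F0 G0; rewrite ge0_integralD//.
  - by rewrite !ge0_integralZl_EFin.
  - by move=> z _; rewrite mule_ge0// lee_fin.
  - exact: measurable_funeM.
  - by move=> z _; rewrite mule_ge0// lee_fin.
  - exact: measurable_funeM.
have up (e : R) n : 0 < e -> (U n <= (1 + e)%:E * v%:E + (1 + e^-1)%:E * D n)%E.
  move=> e0; have ei : 0 < e^-1 by rewrite invr_gt0.
  rewrite -gv -comb// ?addr_ge0// ?(ltW e0)// ?(ltW ei)//.
  apply: ge0_le_integral => //.
  - by apply: emeasurable_funD; exact: measurable_funeM.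
  - move=> z _; rewrite -!EFinM -EFinD lee_fin.
    set x := f n z; set y := g z.
    rewrite -subr_ge0 (_ : _ - _ = e^-1 * ((1 + e) * y - x) ^+ 2).
      by rewrite mulr_ge0 ?sqr_ge0// ltW.
    by field; rewrite gt_eqF.
have lo (e : R) n : 0 < e < 1 -> ((1 - e)%:E * v%:E <= U n + e^-1%:E * D n)%E.
  move=> /andP[e0 e1]; have ei : 0 < e^-1 by rewrite invr_gt0.
  rewrite -[U n]mul1e -comb// ?(ltW ei)//.
  rewrite -gv -ge0_integralZl_EFin ?subr_ge0 ?(ltW e1)//.
  apply: ge0_le_integral => //.
  - by move=> z _; rewrite -EFinM lee_fin mulr_ge0 ?sqr_ge0// subr_ge0 ltW.
  - exact: measurable_funeM.
  - by apply: emeasurable_funD; exact: measurable_funeM.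
  - move=> z _; rewrite mul1e -!EFinM -EFinD lee_fin.
    set x := f n z; set y := g z.
    rewrite -subr_ge0 (_ : _ - _ = e * (y + (x - y) / e) ^+ 2 + (x - y) ^+ 2).
      by rewrite addr_ge0 ?sqr_ge0// mulr_ge0 ?sqr_ge0// ltW.
    by field; rewrite gt_eqF.
have Dfin : \forall n \near \oo, D n \is a fin_num.
  by have [] := (fine_cvgP _ _).1 D0.
have Dr0 : fine (D n) @[n --> \oo] --> (0 : R).
  by have [] := (fine_cvgP _ _).1 D0.
have Ufin : \forall n \near \oo, U n \is a fin_num.
  near=> n; have Dn : D n \is a fin_num by near: n.
  rewrite ge0_fin_numE; last by apply: integral_ge0 => z _.
  apply: (le_lt_trans (up 1 n ltr01)).
  by rewrite -(fineK Dn) -!EFinM -EFinD ltry.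
apply: cvg_EFin => //; apply/cvgrPdist_le => e e0.
(* The first bound keeps [h < 1], as [lo] requires; the second gives [h * v <= e / 2], with [v + 1]
   in case [v = 0]. *)
pose h := Num.min (2^-1) (e / 2 / (v + 1)).
have v1 : 0 < v + 1 by rewrite ltr_wpDl.
have h0 : 0 < h by rewrite lt_min invr_gt0 ltr0n/= !divr_gt0.
have h1 : h < 1 by rewrite gt_min invf_lt1// ltr1n.
have hv : h * v <= e / 2.
  rewrite (@le_trans _ _ (e / 2 / (v + 1) * (v + 1)))//; last by rewrite divfK ?gt_eqF.
  apply: ler_pM => //; [exact: ltW|by rewrite ge_min lexx orbT|by rewrite lerDl].
have k0 : 0 < 1 + h^-1 by rewrite addr_gt0// invr_gt0.
near=> n.
have Dn : D n \is a fin_num by near: n.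
have Un : U n \is a fin_num by near: n.
have Dsmall : fine (D n) <= e / 2 / (1 + h^-1).
  apply: le_trans (ler_norm _) _; rewrite -[X in `|X|]subr0 distrC; near: n.
  by move/cvgrPdist_le : Dr0; apply; rewrite !divr_gt0.
have Dpos : 0 <= fine (D n) by rewrite fine_ge0// integral_ge0.
have Db : (1 + h^-1) * fine (D n) <= e / 2.
  by rewrite mulrC -ler_pdivlMr.
have := up h n h0; have := lo h n; rewrite h0 h1 => /(_ isT).
rewrite -(fineK Dn) -(fineK Un) -!EFinM -!EFinD !lee_fin => H1 H2.
rewrite /= ler_norml; apply/andP; split.
  move: H2 hv Db; rewrite !mulrDl mul1r; set a := h^-1 * _; set b := h * v; lra.
have ah : h^-1 * fine (D n) <= e / 2.
  apply: le_trans Db; rewrite mulrDl lerDr mul1r//.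
move: H1 hv ah; rewrite mulrBl mul1r; set a := h^-1 * _; set b := h * v; lra.
Unshelve. all: by end_near.
Qed.

(** Follows from [(a p + b q)^2 <= 2 a^2 p^2 + 2 b^2 q^2]. *)
Lemma cvg0_integral_sqr_comb (R : realType) d (T : measurableType d)
    (mu : {measure set T -> \bar R}) (p q : nat -> T -> R) (a b : R) :
  (forall n, measurable_fun setT (p n)) -> (forall n, measurable_fun setT (q n)) ->
  (\int[mu]_z ((p n z) ^+ 2)%:E)%E @[n --> \oo] --> 0%E ->
  (\int[mu]_z ((q n z) ^+ 2)%:E)%E @[n --> \oo] --> 0%E ->
  (\int[mu]_z ((a * p n z + b * q n z) ^+ 2)%:E)%E @[n --> \oo] --> 0%E.
Proof.
move=> mp mq p0 q0.
have c0 (c : R) : 0 <= 2 * c ^+ 2 by apply: mulr_ge0 => //; exact: sqr_ge0.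
have mpq n : measurable_fun [set: T] (fun z => a * p n z + b * q n z).
  by apply: measurable_funD; exact: measurable_funM.
have m2 (f : T -> R) : measurable_fun setT f -> measurable_fun setT (fun z => (f z ^+ 2)%:E).
  by move=> mf; apply/measurable_EFinP; exact: measurable_funX.
have s2 (f : T -> R) z : (0 <= (f z ^+ 2)%:E)%E by rewrite lee_fin sqr_ge0.
apply: (@squeeze_cvge _ _ _ _ (cst 0%E) _ (fun n =>
  ((2 * a ^+ 2)%:E * \int[mu]_z ((p n z) ^+ 2)%:E +
   (2 * b ^+ 2)%:E * \int[mu]_z ((q n z) ^+ 2)%:E)%E)).
- apply: nearW => n; rewrite integral_ge0 /=; last by move=> z _; exact: (s2 (fun z => a * p n z + b * q n z)).
  have Zl (c : R) (f : T -> R) : measurable_fun setT f -> 0 <= c ->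
      (c%:E * \int[mu]_z (f z ^+ 2)%:E = \int[mu]_z (c%:E * (f z ^+ 2)%:E))%E.
    by move=> mf cge0; rewrite ge0_integralZl_EFin//; exact: m2.
  rewrite !Zl//.
  rewrite -ge0_integralD//; last 4 first.
  + by move=> z _; rewrite -EFinM lee_fin; apply: mulr_ge0 => //; exact: sqr_ge0.
  + by apply: measurable_funeM; exact: m2.
  + by move=> z _; rewrite -EFinM lee_fin; apply: mulr_ge0 => //; exact: sqr_ge0.
  + by apply: measurable_funeM; exact: m2.
  apply: ge0_le_integral => //.
  + by move=> z _; exact: (s2 (fun z => a * p n z + b * q n z)).
  + exact: m2.
  + by apply: emeasurable_funD; apply: measurable_funeM; exact: m2.
  + move=> z _; rewrite -!EFinM -EFinD lee_fin -subr_ge0.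
    rewrite (_ : _ - _ = (a * p n z - b * q n z) ^+ 2) ?sqr_ge0//; ring.
- exact: cvg_cst.
- rewrite -[X in _ --> X]adde0; apply: cvgeD => //.
  + by rewrite -(mule0 (2 * a ^+ 2)%:E); exact: cvgeZl.
  + by rewrite -(mule0 (2 * b ^+ 2)%:E); exact: cvgeZl.
Qed.

Section wiener.
Import HBSimple.
Context (R : realType) d (Omega : measurableType d) (P : probability Omega R).
Context (L : set (space_time (R := R)) -> {RV P >-> R}) (hL : white_noise L).

Local Notation leb := (@space_time_leb R).

(** The product is dominated by [L A ^ 2 + L B ^ 2], whose expectation is a sum of two finite areas.
    Integrability is what allows the signed double sum of the isometry to be integrated term by
    term. *)
Lemma white_noise_integrableM (A B : set (space_time (R := R))) :
  finite_area A -> finite_area B ->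
  P.-integrable setT (fun w => (L A w * L B w)%:E).
Proof.
move=> fA fB.
have sqi C : finite_area C -> P.-integrable setT (fun w => (L C w ^+ 2)%:E).
  move=> fC; apply/integrableP; split.
    by apply/measurable_EFinP; exact: measurable_funX.
  under eq_integral do rewrite gee0_abs ?lee_fin ?sqr_ge0//.
  have := white_noise_cov hL fC fC; rewrite setIid unlock => ->.
  by case: fC.
have mAB : measurable_fun setT (fun w => (L A w * L B w)%:E).
  by apply/measurable_EFinP; exact: measurable_funM.
apply: (@le_integrable _ _ _ P setT measurableT _
  (fun w => ((L A w ^+ 2)%:E + (L B w ^+ 2)%:E)%E)) => //.
- move=> w _; rewrite -EFinD !abse_EFin lee_fin [leRHS]ger0_norm ?addr_ge0 ?sqr_ge0//.
  by rewrite ler_norml; apply/andP; split; nra.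
- by apply: integrableD => //; exact: sqi.
Qed.

(** Both squares expand into the same double sum, the integral of [\1_A * \1_B] being the covariance
    of [L A] and [L B]. The sets may overlap, as they do when two simple functions are combined
    below. *)
Lemma white_noise_isometry (n : nat) (c : 'I_n -> R)
    (A : 'I_n -> set (space_time (R := R))) : (forall i, finite_area (A i)) ->
  ('E_P[fun w => ((\sum_(i < n) c i * L (A i) w) ^+ 2)%R] =
   \int[leb]_z ((\sum_(i < n) c i * \1_(A i) z) ^+ 2)%:E)%E.
Proof.
move=> fA; have mA i : measurable (A i) by case: (fA i).
have sq2 (x : 'I_n -> R) : ((\sum_(i < n) c i * x i) ^+ 2)%:E =
    (\sum_(p : 'I_n * 'I_n) (c p.1 * c p.2)%:E * (x p.1 * x p.2)%:E)%E.
  rewrite expr2 big_distrlr/= pair_big/= -sumEFin; apply: eq_bigr => p _.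
  by rewrite -EFinM mulrACA.
have indM p z : \1_(A p.1) z * \1_(A p.2) z = \1_(A p.1 `&` A p.2) z :> R.
  by rewrite indicI.
have area p : (leb (A p.1 `&` A p.2) < +oo)%E.
  apply: (@le_lt_trans _ _ (leb (A p.1))); last by case: (fA p.1).
  by apply: le_measure; rewrite ?inE//; exact: measurableI.
have ii p : leb.-integrable setT (fun z => (\1_(A p.1) z * \1_(A p.2) z)%:E).
  under eq_fun do rewrite indM.
  have mAp : measurable (A p.1 `&` A p.2) by exact: measurableI.
  apply/integrableP; split; first by apply/measurable_EFinP; exact: measurable_indic.
  under eq_integral do rewrite gee0_abs ?lee_fin//.
  by rewrite integral_indic// setIT.
rewrite unlock.
under eq_integral do rewrite sq2.
under [RHS]eq_integral do rewrite sq2.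
rewrite !integral_sum//; last 2 first.
- by move=> p; apply: integrableZl => //; exact: ii.
- by move=> p; apply: integrableZl => //; exact: white_noise_integrableM.
apply: eq_bigr => p _; rewrite !integralZl//; last exact: white_noise_integrableM.
congr (_ * _)%E; have := white_noise_cov hL (fA p.1) (fA p.2).
rewrite unlock => ->; under eq_integral do rewrite indM.
by rewrite integral_indic ?setIT//; exact: measurableI.
Qed.

(** Dropping the value 0 leaves level sets of finite area, because each nonzero value squared times
    its area is at most the integral of [h ^ 2] over [A]. The same coefficients and sets represent
    both the integral and the restricted function, which is what the isometry compares. *)
Lemma elementary_integralE (A : set (space_time (R := R)))
    (h : {sfun space_time (R := R) >-> R}) :
  measurable A -> A `<=` @half_plane R ->
  (\int[leb]_(z in A) ((h z) ^+ 2)%:E < +oo)%E ->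
  exists n (c : 'I_n -> R) (B : 'I_n -> set (space_time (R := R))),
  [/\ forall i, finite_area (B i),
      forall w, elementary_integral L A h w = \sum_(i < n) c i * L (B i) w &
      forall z, (h \_ A) z = \sum_(i < n) c i * \1_(B i) z].
Proof.
move=> mA Ah hfin.
have finh : finite_set (range h) by exact: fimfunP.
pose s := [seq r <- finmap.enum_fset (fset_set (range h)) | r != 0].
have sE (F : R -> R) : F 0 = 0 -> \sum_(r \in range h) F r = \sum_(i < size s) F s`_i.
  move=> F0; rewrite fsbig_finite//= (bigID (fun r => r != 0))/=.
  rewrite [X in _ + X]big1 => [|r /negPn/eqP->//]; rewrite addr0.
  by rewrite -big_filter (big_nth 0) big_mkord.
exists (size s), (fun i => s`_i), (fun i => A `&` h @^-1` [set s`_i]); split.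
- move=> i; have mh : measurable (h @^-1` [set s`_i]) by [].
  split; [exact: measurableI|by move=> z [/Ah]|].
  have s0 : 0 < s`_i ^+ 2.
    rewrite exprn_even_gt0//=.
    by have := mem_nth 0 (ltn_ord i); rewrite mem_filter => /andP[].
  have mAh : measurable (A `&` h @^-1` [set s`_i]) by exact: measurableI.
  rewrite -(@lte_pmul2l _ (s`_i ^+ 2)%:E) ?lte_fin// mulry gtr0_sg// mul1e.
  apply: le_lt_trans hfin.
  rewrite -integral_cst//.
  apply: (@le_trans _ _ (\int[leb]_(z in A `&` h @^-1` [set s`_i]) ((h z) ^+ 2)%:E)%E).
    by rewrite le_eqVlt; apply/orP; left; apply/eqP; apply: eq_integral => z; rewrite inE => -[_ /= ->].
  apply: ge0_subset_integral => //.
  - by apply: measurable_funTS; apply/measurable_EFinP; exact: measurable_funX.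
  - by move=> z _; rewrite lee_fin sqr_ge0.
- by move=> w; rewrite /elementary_integral (sE (fun r => r * L (A `&` h @^-1` [set r]) w)) ?mul0r.
- move=> z; rewrite -(sE (fun r => r * \1_(A `&` h @^-1` [set r]) z)) ?mul0r//.
  rewrite patchE; case: ifPn => zA; last first.
    rewrite fsbig1// => r _; rewrite indicE (_ : _ \in _ = false) ?mulr0//.
    by apply/negbTE/negP; rewrite inE => -[]; rewrite -in_setE (negPf zA).
  rewrite fimfunE; apply: eq_fsbigr => r _; congr (_ * _).
  by rewrite indicI/= (_ : \1_A z = 1) ?mul1r// indicE zA.
Qed.

(** The combination is an L^2 limit of finite linear combinations of noise values, which are centred
    Gaussian. By the isometry their variances are integrals of squared simple functions, and these
    converge to [v]. Restricting the integrands to [A] and [B] places both on the whole space, where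
    they can be added. *)
Lemma wiener_integral_expR (A B : set (space_time (R := R)))
    (f g : space_time (R := R) -> R) (X Y : {RV P >-> R}) (a b v : R) :
  measurable A -> A `<=` @half_plane R -> measurable B -> B `<=` @half_plane R ->
  measurable_fun setT (f \_ A) -> measurable_fun setT (g \_ B) ->
  wiener_integral L A f X -> wiener_integral L B g Y ->
  (\int[leb]_z ((a * (f \_ A) z + b * (g \_ B) z) ^+ 2)%:E = v%:E)%E ->
  ('E_P[fun w => expR (a * X w + b * Y w)] = (expR (v / 2))%:E)%E.
Proof.
move=> mA Ah mB Bh mf mg [h [hfin hf hX]] [k [kfin kg kY]] vE.
have eA n := elementary_integralE A (h n) mA Ah (hfin n).
have eB n := elementary_integralE B (k n) mB Bh (kfin n).
pose S1 n := elementary_integral L A (h n).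
pose S2 n := elementary_integral L B (k n).
have mS n : measurable_fun setT (S1 n) /\ measurable_fun setT (S2 n).
  split.
  - have [m [c [C [_ cE _]]]] := eA n; rewrite (_ : S1 n = (\sum_(i < m) c i *: L (C i))%R).
      exact: measurable_funPT.
    by apply/funext => w; rewrite mfun_linE -cE.
  - have [m [c [C [_ cE _]]]] := eB n; rewrite (_ : S2 n = (\sum_(i < m) c i *: L (C i))%R).
      exact: measurable_funPT.
    by apply/funext => w; rewrite mfun_linE -cE.
have /choice[Z ZE] : forall n, exists Z : {RV P >-> R}, [/\ centered_gaussian Z,
    forall w, Z w = a * S1 n w + b * S2 n w &
    ('E_P[fun w => (Z w ^+ 2)%R] =
      \int[leb]_z ((a * (h n \_ A) z + b * (k n \_ B) z) ^+ 2)%:E)%E].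
  move=> n; have [m1 [c1 [C1 [fin1 S1E h1]]]] := eA n.
  have [m2 [c2 [C2 [fin2 S2E h2]]]] := eB n.
  (* Concatenating the two families makes [a S1 + b S2] a single linear combination, to which the
     joint Gaussianity of the noise applies. *)
  pose c (i : 'I_(m1 + m2)) := match fintype.split i with inl j => a * c1 j | inr j => b * c2 j end.
  pose C (i : 'I_(m1 + m2)) := match fintype.split i with inl j => C1 j | inr j => C2 j end.
  have finC i : finite_area (C i) by rewrite /C; case: fintype.split => j.
  have sumE (F : set (space_time (R := R)) -> R) : \sum_(i < m1 + m2) c i * F (C i) =
      a * (\sum_(i < m1) c1 i * F (C1 i)) + b * (\sum_(i < m2) c2 i * F (C2 i)).
    rewrite big_split_ord/= !mulr_sumr; congr (_ + _); apply: eq_bigr => i _.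
      by rewrite /c /C (unsplitK (inl i)) mulrA.
    by rewrite /c /C (unsplitK (inr i)) mulrA.
  exists (\sum_(i < m1 + m2) c i *: L (C i)); split.
  - exact: (white_noise_gaussian hL).
  - by move=> w; rewrite mfun_linE (sumE (fun D => L D w)) -S1E -S2E.
  - under eq_fun do rewrite mfun_linE.
    rewrite white_noise_isometry//; apply: eq_integral => z _.
    by rewrite (sumE (fun D => \1_D z)) -h1 -h2.
pose W : {RV P >-> R} := (a *: X + b *: Y)%R.
have WE w : W w = a * X w + b * Y w by [].
under eq_fun do rewrite -WE.
apply: (expectation_expR_limit _ _ _ _ Z) => //.
- by move=> n; have [] := ZE n.
- rewrite unlock.
  have -> : (fun n => \int[P]_w ((Z n w - W w) ^+ 2)%:E)%E =
      (fun n => \int[P]_w ((a * (S1 n w - X w) + b * (S2 n w - Y w)) ^+ 2)%:E)%E.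
    apply/funext => n; apply: eq_integral => w _; have [_ -> _] := ZE n.
    by rewrite WE; congr (_ ^+ 2)%:E; ring.
  apply: cvg0_integral_sqr_comb.
  + by move=> n; apply: measurable_funB => //; exact: (mS n).1.
  + by move=> n; apply: measurable_funB => //; exact: (mS n).2.
  + by move: hX; rewrite unlock.
  + by move: kY; rewrite unlock.
- have -> : (fun n => 'E_P[fun w => (Z n w ^+ 2)%R])%E =
    (fun n => \int[leb]_z ((a * (h n \_ A) z + b * (k n \_ B) z) ^+ 2)%:E)%E.
    by apply/funext => n; have [] := ZE n.
  have mpatch (D : set (space_time (R := R))) (l : {sfun space_time (R := R) >-> R}) :
      measurable D -> measurable_fun setT (l \_ D).
    by move=> mD; apply/(measurable_restrictT _ mD); exact: measurable_funTS.
  apply: (cvg_integral_sqr _ _ _ _ _ (fun z => a * (f \_ A) z + b * (g \_ B) z)) => //.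
  + by move=> n; apply: measurable_funD; apply: measurable_funM => //; exact: mpatch.
  + by apply: measurable_funD; exact: measurable_funM.
  have -> : (fun n => \int[leb]_z ((a * (h n \_ A) z + b * (k n \_ B) z
        - (a * (f \_ A) z + b * (g \_ B) z)) ^+ 2)%:E)%E =
     (fun n => \int[leb]_z ((a * ((h n \_ A) z - (f \_ A) z)
        + b * ((k n \_ B) z - (g \_ B) z)) ^+ 2)%:E)%E.
    by apply/funext => n; apply: eq_integral => z _; congr (_ ^+ 2)%:E; ring.
  have patchB (D : set (space_time (R := R))) (l m : space_time (R := R) -> R) :
     (\int[leb]_(z in D) ((l z - m z) ^+ 2)%:E =
      \int[leb]_z (((l \_ D) z - (m \_ D) z) ^+ 2)%:E)%E.
    rewrite integral_mkcond; apply: eq_integral => z _; rewrite !patchE.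
    by case: ifP => // _; rewrite subrr expr0n.
  apply: cvg0_integral_sqr_comb.
  + by move=> n; apply: measurable_funB => //; exact: mpatch.
  + by move=> n; apply: measurable_funB => //; exact: mpatch.
  + by move: hf; under eq_fun do rewrite patchB.
  + by move: kg; under eq_fun do rewrite patchB.
Qed.

End wiener.

(** * Covariance of the solution *)

Section heat_covariance.
Context (R : realType).

Lemma heat_kernelE (p y : R) : 0 < p ->
  heat_kernel p y = normal_pdf 0 (Num.sqrt (2 * p)) y.
Proof.
move=> p0; have p2 : 0 < 2 * p by rewrite mulr_gt0.
rewrite normal_pdfE ?gt_eqF ?sqrtr_gt0// /heat_kernel /normal_peak /normal_fun.
rewrite sqr_sqrtr ?(ltW p2)// powRN powR12_sqrt; last first.
  by rewrite !mulr_ge0 ?pi_ge0// ltW.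
congr ((Num.sqrt _)^-1 * expR _); first by rewrite -mulr_natr; ring.
by field; rewrite gt_eqF.
Qed.

(** The inverse times add up in the exponent, hence the time [p * q / (p + q)]. *)
Lemma heat_kernelM (p q y : R) : 0 < p -> 0 < q ->
  heat_kernel p y * heat_kernel q y =
  (Num.sqrt (4 * pi * (p + q)))^-1 * heat_kernel (p * q / (p + q)) y.
Proof.
move=> p0 q0; have pq : 0 < p + q by rewrite addr_gt0.
have pi0 : 0 < pi :> R by exact: pi_gt0.
have P (x : R) : 0 < x -> 0 <= 4 * pi * x by move=> x0; rewrite !mulr_ge0// ltW.
rewrite /heat_kernel !powRN !powR12_sqrt ?P ?divr_gt0 ?mulr_gt0//.
rewrite mulrACA [RHS]mulrA; congr (_ * _).
  rewrite -!invfM -!sqrtrM ?P//; congr (Num.sqrt _)^-1.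
  by field; rewrite gt_eqF.
rewrite -expRD; congr expR; field.
by rewrite !gt_eqF//.
Qed.

(** The value is the heat kernel of time [p + q] at 0: this is its semigroup property, read at the
    origin. *)
Lemma integral_heat_kernelM (p q : R) : 0 < p -> 0 < q ->
  (\int[lebesgue_measure]_y (heat_kernel p y * heat_kernel q y)%:E =
   ((4 * pi * (p + q)) `^ (- 2^-1))%:E)%E.
Proof.
move=> p0 q0; have r0 : 0 < p * q / (p + q) by rewrite divr_gt0 ?mulr_gt0 ?addr_gt0.
under eq_integral do rewrite heat_kernelM// heat_kernelE// EFinM.
rewrite ge0_integralZl_EFin//.
- rewrite integral_normal_pdf mule1 powRN powR12_sqrt//.
  by rewrite !mulr_ge0 ?pi_ge0// addr_ge0 ?ltW.
- by move=> y _; rewrite lee_fin normal_pdf_ge0.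
- by apply/measurable_EFinP; exact: measurable_normal_pdf.
Qed.

Definition heat_cov (s t : R) : R :=
  (Num.sqrt (s + t) - Num.sqrt (t - s)) / Num.sqrt (4 * pi).

(** The fundamental theorem of calculus, applied short of [s]: when [s = t] the integrand is
    singular at [r = s]. *)
Lemma integral_inv_sqrt (c s t : R) : 0 < c -> c < s -> s <= t ->
  (\int[lebesgue_measure]_(r in `[0%R, c]) ((Num.sqrt (4 * pi * (s + t - 2 * r)))^-1)%:E =
   ((Num.sqrt (s + t) - Num.sqrt (s + t - 2 * c)) / Num.sqrt (4 * pi))%:E)%E.
Proof.
move=> c0 cs st.
have pos r : r <= c -> 0 < s + t - 2 * r by move=> rc; lra.
have pi4 : 0 < 4 * pi :> R by rewrite mulr_gt0 ?pi_gt0.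
have sq4 : 0 < Num.sqrt (4 * pi) :> R by rewrite sqrtr_gt0.
pose F (r : R) := - (Num.sqrt (s + t - 2 * r) / Num.sqrt (4 * pi)).
have cF : continuous F.
  move=> r; apply: cvgN; apply: cvgMr_tmp.
  apply: (cvg_comp (fun r => s + t - 2 * r)); last exact: sqrt_continuous.
  apply: cvgB; first exact: cvg_cst.
  by apply: cvgMl_tmp; exact: cvg_id.
have dF r : r <= c -> is_derive r 1 F (Num.sqrt (4 * pi * (s + t - 2 * r)))^-1.
  move=> rc; have p := pos r rc; have := is_derive1_sqrt p => ds.
  have dg : is_derive r 1 (fun r : R => s + t - 2 * r) (- 2).
    rewrite [X in is_derive _ _ X](_ : _ = (cst (s + t) - (2 *: id))%R); last first.
      by apply/funext => x.
    apply: is_derive_eq; rewrite sub0r; congr (- _); exact: mulr1.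
  have := @is_derive1_comp R Num.sqrt (fun r : R => s + t - 2 * r) r _ _ ds dg.
  rewrite /F => dc.
  rewrite [X in is_derive _ _ X](_ : _ = (- (Num.sqrt (4 * pi))^-1) *: (Num.sqrt \o (fun r : R => s + t - 2 * r))); last first.
    apply/funext => x; rewrite -[RHS]/(- (Num.sqrt (4 * pi))^-1 * Num.sqrt (s + t - 2 * x)).
    by rewrite mulNr mulrC.
  have := is_deriveZ (- (Num.sqrt (4 * pi))^-1) dc.
  congr (is_derive _ _ _ _); rewrite [in RHS]sqrtrM ?(ltW pi4)//.
  rewrite -[LHS]/(- (Num.sqrt (4 * pi))^-1 * ((2 * Num.sqrt (s + t - 2 * r))^-1 * - 2)).
  by field; rewrite !gt_eqF// sqrtr_gt0.
rewrite (@continuous_FTC2 R _ F)//.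
- rewrite -EFinB; congr EFin; rewrite /F mulr0 subr0; field.
  by rewrite gt_eqF.
- apply: continuous_in_subspaceT => r; rewrite inE/= in_itv/= => /andP[_ rc].
  apply: cvgV; first by rewrite gt_eqF// sqrtr_gt0 mulr_gt0// pos.
  apply: (cvg_comp (fun r => 4 * pi * (s + t - 2 * r))); last exact: sqrt_continuous.
  apply: cvgMl_tmp; apply: cvgB; first exact: cvg_cst.
  by apply: cvgMl_tmp; exact: cvg_id.
- split.
  + by move=> r; rewrite in_itv/= => /andP[_ /ltW rc]; have [] := dF r rc.
  + by apply: cvg_at_right_filter; exact: cF.
  + by apply: cvg_at_left_filter; exact: cF.
- move=> r; rewrite in_itv/= => /andP[_ /ltW rc].
  by rewrite derive1E; have := dF r rc => /@derive_val.
Qed.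

Lemma integral_inv_sqrt_open (s t : R) : 0 < s -> s <= t ->
  (\int[lebesgue_measure]_(r in `[0%R, s[) ((4 * pi * (s + t - 2 * r)) `^ (- 2^-1))%:E =
   (heat_cov s t)%:E)%E.
Proof.
move=> s0 st.
(* Increases to [s] from strictly below; the factor [2^-1] makes [c 0] positive. *)
pose c (n : nat) : R := s * (1 - 2^-1 * n.+1%:R^-1).
have h1 n : 0 < (2^-1 * n.+1%:R^-1 : R) < 1.
    have n0 : (0 : R) < n.+1%:R by rewrite ltr0n.
  rewrite mulr_gt0 ?invr_gt0//= -invfM invf_lt1 ?mulr_gt0//.
  by have := ler0n R n; rewrite -natr1; lra.
have c0 n : 0 < c n by rewrite mulr_gt0// subr_gt0; have /andP[] := h1 n.
have cs n : c n < s by rewrite gtr_pMr// ltrBlDr ltrDl; have /andP[] := h1 n.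
have cvc : c n @[n --> \oo] --> s.
  have -> : nbhs s = nbhs (s * (1 - 2^-1 * 0)) by rewrite mulr0 subr0 mulr1.
  apply: cvgMl_tmp; apply: cvgB; first exact: cvg_cst.
  by apply: cvgMl_tmp; exact: cvg_harmonic.
have ndc : {homo c : n m / (n <= m)%N >-> n <= m}.
  move=> n m nm; rewrite ler_pM2l// lerD2l lerN2 ler_pM2l// lef_pV2 ?posrE//.
  by rewrite ler_nat ltnS.
have UE : `[0%R, s[%classic = \bigcup_n `[0%R, c n]%classic.
  apply/seteqP; split => [r /=|r [n _ /=]]; rewrite !in_itv/=; last first.
    by move=> /andP[-> /le_lt_trans->].
  move=> /andP[r0 rs].
  have [N _ HN] : \forall n \near \oo, r < c n.
    by apply: (cvgr_gt s) => //.
  by exists N => //=; rewrite in_itv/= r0 ltW// HN/=.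
have cF : (\int[lebesgue_measure]_(r in `[0%R, c n])
    ((4 * pi * (s + t - 2 * r)) `^ (- 2^-1))%:E)%E @[n --> \oo] --> (heat_cov s t)%:E.
  rewrite (_ : (fun n => _) = (fun n => ((Num.sqrt (s + t) - Num.sqrt (s + t - 2 * c n)) / Num.sqrt (4 * pi))%:E)); last first.
    apply/funext => n; rewrite -(integral_inv_sqrt (c n))//.
    apply: eq_integral => r; rewrite inE/= in_itv/= => /andP[_ rc].
    rewrite powRN powR12_sqrt// !mulr_ge0// ?pi_ge0//.
    by have := cs n; lra.
  apply: cvg_EFin; first exact: nearW.
  rewrite /heat_cov; apply: cvgMr_tmp; apply: cvgB; first exact: cvg_cst.
  apply: (cvg_comp _ Num.sqrt); last exact: sqrt_continuous.
  rewrite (_ : t - s = s + t - 2 * s); last by ring.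
  by apply: cvgB; [exact: cvg_cst|exact: cvgMl_tmp].
rewrite UE; apply: (cvg_unique (@ereal_hausdorff R) _ cF).
apply: ge0_nondecreasing_set_cvg_integral.
- by move=> n m nm; apply/subsetPset => r /=; rewrite !in_itv/= => /andP[-> /le_trans->//]; exact: ndc.
- by [].
- move=> n; apply/measurable_EFinP.
  apply: measurable_funTS.
  apply: (measurableT_comp (measurable_powR (- 2^-1))).
  by apply: measurable_funM => //; apply: measurable_funB => //; exact: measurable_funM.
- by move=> n r _; rewrite lee_fin powR_ge0.
Qed.

Definition heat_slab (t : R) : set (space_time (R := R)) := `[0, t[ `*` [set: R].

Definition heat_at0 (t : R) (z : space_time (R := R)) : R :=
  heat_kernel (t - z.1) (0 - z.2).

(** Writing the inverse as a power reduces measurability of the kernel to that of [powR]. *)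
Lemma heat_at0E (t : R) z : heat_slab t z -> heat_at0 t z =
  (4 * pi * (t - z.1)) `^ (- 2^-1) * expR (- (z.2 ^+ 2 * (4 * (t - z.1)) `^ (- 1))).
Proof.
move=> [/= ]; rewrite in_itv/= => /andP[_ zt] _.
rewrite /heat_at0 /heat_kernel sub0r sqrrN powR_inv1//.
by rewrite mulr_ge0// subr_ge0 ltW.
Qed.

Lemma measurable_heat_slab (t : R) : measurable (heat_slab t).
Proof. exact: measurableX. Qed.

Lemma measurable_heat_at0 (t : R) :
  measurable_fun [set: space_time (R := R)] (heat_at0 t \_ (heat_slab t)).
Proof.
apply/(measurable_restrictT _ (measurable_heat_slab t)).
have m1 : measurable_fun (heat_slab t) (fun z : space_time (R := R) => t - z.1 : R).
  by apply: measurable_funTS; apply: measurable_funB => //; exact: measurable_fst.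
have m2 : measurable_fun (heat_slab t) (fun z : space_time (R := R) => z.2 : R).
  by apply: measurable_funTS; exact: measurable_snd.
have mp (a b : R) : measurable_fun (heat_slab t)
    (fun z : space_time (R := R) => (a * (t - z.1)) `^ b).
  apply: (measurableT_comp (measurable_powR b)).
  by apply: measurable_funM.
apply: (eq_measurable_fun (fun z : space_time (R := R) =>
  (4 * pi * (t - z.1)) `^ (- 2^-1) * expR (- (z.2 ^+ 2 * (4 * (t - z.1)) `^ (- 1))))).
  by move=> z; rewrite inE => /heat_at0E.
apply: measurable_funM; first exact: mp.
apply: measurableT_comp => //; apply: measurableT_comp => //.
by apply: measurable_funM; [exact: measurable_funX|exact: mp].
Qed.

(** By Tonelli, the space integral at a fixed time [r < s] is the kernel of time [(s - r) + (t - r)]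
    at 0; for other [r] the smaller slab makes the integrand vanish. *)
Lemma heat_at0_covariance (s t : R) : 0 < s -> s <= t ->
  (\int[@space_time_leb R]_z
     ((heat_at0 s \_ (heat_slab s)) z * (heat_at0 t \_ (heat_slab t)) z)%:E =
   (heat_cov s t)%:E)%E.
Proof.
move=> s0 st.
have mst : measurable_fun [set: space_time (R := R)]
   (fun z => ((heat_at0 s \_ (heat_slab s)) z * (heat_at0 t \_ (heat_slab t)) z)%:E).
  by apply/measurable_EFinP; apply: measurable_funM; exact: measurable_heat_at0.
have hk0 p y : 0 <= heat_kernel p y :> R by rewrite mulr_ge0 ?powR_ge0 ?expR_ge0.
have p0 u z : 0 <= (heat_at0 u \_ (heat_slab u)) z.
  by rewrite patchE; case: ifP => // _; exact: hk0.
rewrite /space_time_leb fubini_tonelli1//; last by move=> z; rewrite lee_fin mulr_ge0.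
rewrite -integral_inv_sqrt_open// [RHS]integral_mkcond.
apply: eq_integral => r _; rewrite patchE /fubini_F.
case: ifPn => rs; last first.
  rewrite integral0_eq// => y _; rewrite [in X in X * _]patchE.
  rewrite (_ : (r, y) \in heat_slab s = false) ?mul0r//.
  by apply/negbTE; apply: contra rs => /set_mem[/= h _]; exact/mem_set.
move: rs; rewrite inE/= in_itv/= => /andP[r0 rs].
have H u y : s <= u -> (heat_at0 u \_ (heat_slab u)) (r, y) = heat_kernel (u - r) y.
  move=> su; rewrite patchE (_ : (r, y) \in heat_slab u = true).
    by rewrite /heat_at0/= /heat_kernel sub0r sqrrN.
  by apply/mem_set; split => //=; rewrite in_itv/= r0 (lt_le_trans rs).
under eq_integral do rewrite !H//.
rewrite integral_heat_kernelM ?subr_gt0 ?(lt_le_trans rs)//.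
by congr ((_ * _) `^ _)%:E; ring.
Qed.

End heat_covariance.

(** * Upper bound *)

(** A point of the grid of level [J] is reached from [t0] with at most one increment per level;
    continuity at [t] covers the remaining distance from the grid to [t]. *)
Lemma dyadic_chaining (R : realType) (x : R -> R) (t0 l S : R) (e : nat -> R) (t : R) :
  0 < l -> t0 <= t <= t0 + l -> {for t, continuous x} ->
  (forall j i, (i < 2 ^ j)%N ->
    `|x (t0 + l * i.+1%:R / 2 ^+ j) - x (t0 + l * i%:R / 2 ^+ j)| <= e j) ->
  (forall J, \sum_(j < J) e j <= S) -> `|x t - x t0| <= S.
Proof.
move=> l0 /andP[t0t tl] xt inc eS.
have e0 j : 0 <= e j.
  by apply: le_trans (inc j 0%N _); rewrite ?expn_gt0.
have grid J i : (i <= 2 ^ J)%N ->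
    `|x (t0 + l * i%:R / 2 ^+ J) - x t0| <= \sum_(j < J.+1) e j.
  elim: J i => [|J IH] i iJ.
    rewrite big_ord1; case: i iJ => [|[|//]] _; last by have := inc 0%N 0%N isT; rewrite mulr0 mul0r addr0.
    by rewrite mulr0 mul0r addr0 subrr normr0.
  have half k : l * (k.*2)%:R / 2 ^+ J.+1 = l * k%:R / 2 ^+ J.
    by rewrite -mul2n natrM exprS invfM; field; rewrite gt_eqF// exprn_gt0.
  rewrite big_ord_recr/=.
  (* An even index already lies on the coarser grid; an odd one is a single step away from its left
     neighbour, which does. *)
  case: (boolP (odd i)) => io; last first.
    have iE : i = (i./2).*2 by rewrite -[LHS]odd_double_half (negPf io).
    rewrite iE half (le_trans (IH _ _)) ?lerDl//.
    by rewrite -leq_double -iE -mul2n -expnS.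
  have iE : i = (i./2).*2.+1 by rewrite -[LHS]odd_double_half io.
  have lt2 : ((i./2).*2 < 2 ^ J.+1)%N by rewrite -iE.
  have := inc J.+1 _ lt2; rewrite -iE half => H.
  have := IH i./2 _; rewrite -leq_double -[X in (_ <= X)%N]mul2n -expnS => /(_ (ltnW lt2)) H2.
  set y := x (t0 + l * i%:R / 2 ^+ J.+1); set z := x (t0 + l * (i./2)%:R / 2 ^+ J).
  rewrite (_ : y - x t0 = (y - z) + (z - x t0)); last by ring.
  rewrite (le_trans (ler_normD _ _))// addrC; exact: lerD.
apply/ler_addgt0Pr => h h0.
have /cvgrPdist_lt/(_ _ h0) := xt.
move=> /nbhs_ballP[r /= r0 Hr].
pose J := (Num.truncn (l / r)).+1.
have lJ : l / 2 ^+ J < r.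
  rewrite ltr_pdivrMr ?exprn_gt0// mulrC -ltr_pdivrMr//.
  apply: lt_trans (truncnS_gt _) _.
  by rewrite -natrX ltr_nat ltn_expl.
pose i := Num.truncn ((t - t0) / l * 2 ^+ J).
have p0 : 0 <= (t - t0) / l * 2 ^+ J.
  by rewrite mulr_ge0// ?exprn_ge0// divr_ge0 ?subr_ge0// ltW.
have /andP[i1 i2] := truncn_itv p0.
have iJ : (i <= 2 ^ J)%N.
  rewrite -(ler_nat R) (le_trans i1)// natrX ler_piMl// ?exprn_ge0//.
  by rewrite ler_pdivrMr// mul1r lerBlDl.
have near_t : `|t - (t0 + l * i%:R / 2 ^+ J)| < r.
  have i1' : l * i%:R / 2 ^+ J <= t - t0.
    rewrite ler_pdivrMr ?exprn_gt0// mulrC -ler_pdivlMr//.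
    by rewrite mulrAC.
  have i2' : t - t0 < l * i%:R / 2 ^+ J + l / 2 ^+ J.
    rewrite [ltLHS](_ : _ = l * ((t - t0) / l * 2 ^+ J) / 2 ^+ J); last first.
      by field; rewrite !gt_eqF// exprn_gt0.
    have -> : l * i%:R / 2 ^+ J + l / 2 ^+ J = l * i.+1%:R / 2 ^+ J by rewrite -natr1; ring.
    by rewrite ltr_pM2r ?invr_gt0 ?exprn_gt0// ltr_pM2l.
  rewrite ger0_norm; lra.
have := Hr _ near_t => /= Hn.
have G := grid J i iJ; have E := eS J.+1.
set y := x (t0 + l * i%:R / 2 ^+ J) in Hn G.
rewrite (_ : x t - x t0 = (x t - y) + (y - x t0)); last by ring.
rewrite (le_trans (ler_normD _ _))// addrC; apply: lerD; last exact: ltW.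
exact: le_trans G E.
Qed.

(* Comparison with the telescoping series of [n ^ (- e)]. *)
Lemma pseries_lty (R : realType) (e : R) : 0 < e ->
  (\sum_(n <oo) (expR (- ((1 + e) * ln n.+1%:R)))%:E < +oo)%E.
Proof.
move=> e0.
have H n : \sum_(0 <= k < n.+1) expR (- ((1 + e) * ln k.+1%:R)) <=
    1 + (1 - expR (- (e * ln n.+1%:R))) / e.
  elim: n => [|n IH].
    by rewrite big_nat1 ln1 !mulr0 oppr0 expR0 subrr mul0r addr0.
  rewrite big_nat_recr//= (le_trans (lerD IH (lexx _)))// -addrA lerD2l.
  set N := n.+2%:R : R; set M := n.+1%:R : R.
  have N0 : 0 < N by rewrite ltr0n.
  have M0 : 0 < M by rewrite ltr0n.
  have NM : N = M + 1 by rewrite /N /M natr1.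
  (* What remains is [e N^(-1-e) <= M^(-e) - N^(-e)]; it follows from [1 + u <= expR u] and
     [1 / N <= ln N - ln M]. *)
  rewrite -lerBrDl -mulrBl ler_pdivlMr//.
  have -> : 1 - expR (- (e * ln N)) - (1 - expR (- (e * ln M))) =
     expR (- (e * ln N)) * (expR (e * (ln N - ln M)) - 1).
    by rewrite mulrBr -expRD mulr1 mulrBr addrA addNr sub0r; ring.
  rewrite mulrDl mul1r opprD addrC expRD -mulrA ler_pM2l ?expR_gt0//.
  rewrite expRN lnK ?posrE// lerBrDr.
  have : 1 + e * (ln N - ln M) <= expR (e * (ln N - ln M)) by exact: expR_ge1Dx.
  apply: le_trans; rewrite addrC lerD2l mulrC ler_pM2l//.
  rewrite -ln_div ?posrE// -[leLHS]opprK lerNl -lnV ?posrE ?divr_gt0// invf_div.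
  have -> : M / N = 1 + - N^-1.
    have -> : M = N - 1 by rewrite NM addrK.
    by rewrite mulrBl divff ?gt_eqF// mul1r.
  apply: le_trans (le_ln1Dx _) _ => //.
  by rewrite ltrN2 invf_lt1// NM ltrDr.
apply: (@le_lt_trans _ _ (1 + e^-1)%:E); last exact: ltry.
apply: lime_le.
  by apply: is_cvg_nneseries => n _ _; rewrite lee_fin expR_ge0.
exists 1%N => // -[//|n] _ /=.
rewrite sumEFin lee_fin (le_trans (H n))// lerD2l ler_pdivrMr// mulVf ?gt_eqF// lerBlDr lerDl.
Qed.

(** * Law of the process and Gaussian tails of its increments *)

Section heat_process.
Context (R : realType) d (Omega : measurableType d) (P : probability Omega R).

(** Joint exponential moments at two ordered positive times; the case [s = t] gives the one-time
    laws. Path continuity is not included and is assumed separately where chaining needs it. *)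
Definition heat_process (X : R -> {RV P >-> R}) := forall (s t a b : R),
  0 < s -> s <= t ->
  ('E_P[fun w => expR (a * X s w + b * X t w)] =
   (expR ((a ^+ 2 * heat_cov R s s + 2 * a * b * heat_cov R s t +
           b ^+ 2 * heat_cov R t t) / 2))%:E)%E.

(** This symmetry reduces the limit inferior to the limit superior. *)
Lemma heat_processN (X : R -> {RV P >-> R}) :
  heat_process X -> heat_process (fun t => - X t).
Proof.
move=> hX s t a b s0 st.
have := hX s t (- a) (- b) s0 st.
rewrite !sqrrN (_ : 2 * - a * - b = 2 * a * b) => [<-|]; last by ring.
by congr expectation; apply/funext => w; rewrite /= !mulNr !mulrN.
Qed.

(** The exponent is half the squared L^2 norm of [a F s + b F t], with [F u] the kernel restricted
    to its slab; expanding it leaves three covariance integrals. *)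
Lemma mild_solution_heat_process (L : set (space_time (R := R)) -> {RV P >-> R})
    (Y : R -> R -> {RV P >-> R}) (X : R -> {RV P >-> R}) :
  white_noise L -> mild_solution L Y ->
  (forall t, 0 <= t -> {ae P, forall w, X t w = Y t 0 w}) ->
  heat_process X.
Proof.
move=> hL hY XY s t a b s0 st.
have t0 : 0 < t by exact: lt_le_trans st.
have -> : ('E_P[fun w => expR (a * X s w + b * X t w)] =
   'E_P[fun w => expR (a * Y s 0%R w + b * Y t 0%R w)])%E.
  have mE (U V : {RV P >-> R}) : measurable_fun [set: Omega]
      (fun w => (expR (a * U w + b * V w))%:E).
    apply/measurable_EFinP; apply: measurableT_comp => //.
    by apply: measurable_funD; exact: measurable_funM.
  rewrite unlock; apply: ae_eq_integral => //.
  have := XY s (ltW s0); have := XY t (ltW t0).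
  by apply: filterS2 => w /= -> ->.
have slab u : heat_slab R u `<=` @half_plane R.
  move=> z [/=]; rewrite in_itv/= => /andP[z0 _] _; split => //=.
  by rewrite in_itv/= z0.
have mslab u := measurable_heat_slab R u.
have mf u := measurable_heat_at0 R u.
pose F u := heat_at0 R u \_ (heat_slab R u).
have F0 u z : 0 <= F u z.
  by rewrite /F patchE; case: ifP => // _; rewrite mulr_ge0 ?powR_ge0 ?expR_ge0.
have iF u v : 0 < u -> u <= v ->
    (@space_time_leb R).-integrable setT (fun z => (F u z * F v z)%:E).
  move=> u0 uv; apply/integrableP; split.
    by apply/measurable_EFinP; apply: measurable_funM; exact: mf.
  under eq_integral do rewrite gee0_abs ?lee_fin ?mulr_ge0//.
  by rewrite heat_at0_covariance// ltry.
apply: (wiener_integral_expR _ _ _ _ _ hL (heat_slab R s) (heat_slab R t)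
   (heat_at0 R s) (heat_at0 R t)) => //.
- exact: (hY s 0 (ltW s0)).
- exact: (hY t 0 (ltW t0)).
under eq_integral => z _.
  rewrite (_ : _ ^+ 2 = a ^+ 2 * (F s z * F s z) + 2 * a * b * (F s z * F t z)
     + b ^+ 2 * (F t z * F t z)); last by rewrite /F; ring.
  rewrite !EFinD !(EFinM (_ ^+ 2)) (EFinM (2 * a * b)); over.
have iZ c u v : 0 < u -> u <= v ->
    (@space_time_leb R).-integrable setT (fun z => c%:E * (F u z * F v z)%:E)%E.
  by move=> u0 uv; apply: integrableZl => //; exact: iF.
rewrite integralD//; [|by apply: integrableD => //; exact: iZ|exact: iZ].
rewrite integralD//; [|exact: iZ|exact: iZ].
rewrite !integralZl//; try exact: iF.
by rewrite !heat_at0_covariance// -!EFinM.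
Qed.

(** Only the moment at the optimal parameter [a / v] is used, and only from above, so [v] may be any
    upper bound of the variance; the increments below need this. *)
Lemma chernoff_gaussian (Z : {RV P >-> R}) (a v : R) : 0 < a -> 0 < v ->
  ('E_P[fun w => expR (a / v * Z w)] <= (expR ((a / v) ^+ 2 * v / 2))%:E)%E ->
  (P [set w | (a <= Z w)%R] <= (expR (- (a ^+ 2 / (2 * v))))%:E)%E.
Proof.
move=> a0 v0 hZ; apply: le_trans (chernoff Z (r := a / v) a _) _; first exact: divr_gt0.
rewrite /mmt_gen_fun (_ : _ \o _ = fun w => expR (a / v * Z w)); last first.
  by apply/funext => w; rewrite /= mulrC.
apply: (@le_trans _ _ ((expR ((a / v) ^+ 2 * v / 2))%:E * (expR (- (a / v * a)))%:E)%E).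
  by apply: lee_wpmul2r => //; rewrite lee_fin expR_ge0.
rewrite -EFinM -expRD lee_fin ler_expR le_eqVlt; apply/orP; left; apply/eqP.
by field; rewrite gt_eqF.
Qed.

Variables (X : R -> {RV P >-> R}) (hX : heat_process X).

Lemma heat_process_tail (t a : R) : 0 < t -> 0 < a ->
  (P [set w | (a <= X t w)%R] <= (expR (- (a ^+ 2 / (2 * heat_cov R t t))))%:E)%E.
Proof.
move=> t0 a0; apply: chernoff_gaussian => //.
  by rewrite /heat_cov subrr sqrtr0 subr0 divr_gt0// sqrtr_gt0 ?addr_gt0// mulr_gt0// pi_gt0.
have := hX t t 0 (a / heat_cov R t t) t0 (lexx t).
rewrite expr0n/= mul0r add0r mulr0 !mul0r add0r.
by under eq_fun do rewrite mul0r add0r; move=> ->.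
Qed.

Lemma heat_cov_increment (s t : R) : 0 < s -> s <= t ->
  heat_cov R s s - 2 * heat_cov R s t + heat_cov R t t <=
  2 * (Num.sqrt (t - s) / Num.sqrt (4 * pi)).
Proof.
move=> s0 st; rewrite /heat_cov !subrr sqrtr0 !subr0.
have p : 0 < Num.sqrt (4 * pi) :> R by rewrite sqrtr_gt0 mulr_gt0// pi_gt0.
rewrite -subr_ge0.
rewrite (_ : _ - _ = (2 * Num.sqrt (s + t) - Num.sqrt (s + s) - Num.sqrt (t + t)) / Num.sqrt (4 * pi)); last first.
  by field; rewrite gt_eqF.
apply: divr_ge0; last exact: ltW.
(* concavity of the square root *)
set x := Num.sqrt (s + s); set y := Num.sqrt (t + t); set z := Num.sqrt (s + t).
have t0 : 0 < t by exact: lt_le_trans st.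
have xE : x ^+ 2 = s + s by rewrite sqr_sqrtr// addr_ge0// ltW.
have yE : y ^+ 2 = t + t by rewrite sqr_sqrtr// addr_ge0// ltW.
have zE : z ^+ 2 = s + t by rewrite sqr_sqrtr// addr_ge0// ltW.
have : x + y <= 2 * z.
  rewrite -(@ler_pXn2r _ 2)// ?nnegrE ?addr_ge0 ?mulr_ge0 ?sqrtr_ge0//.
  rewrite exprMn zE -subr_ge0 (_ : _ - _ = (x - y) ^+ 2) ?sqr_ge0//.
  by rewrite !sqrrD sqrrN xE yE; ring.
lra.
Qed.

Lemma heat_process_increment (s t a : R) : 0 < s -> s < t -> 0 < a ->
  (P [set w | (a <= `|X t w - X s w|)%R] <=
   (2 * expR (- (a ^+ 2 / (4 * (Num.sqrt (t - s) / Num.sqrt (4 * pi))))))%:E)%E.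
Proof.
move=> s0 st a0.
set D := Num.sqrt (t - s) / Num.sqrt (4 * pi).
have D0 : 0 < D by rewrite divr_gt0// sqrtr_gt0 ?subr_gt0// mulr_gt0// pi_gt0.
(* Here [e] is a sign, so that both tails are treated at once; [2 * D] bounds the variance of the
   increment. *)
have H (e : R) : e ^+ 2 = 1 -> (P [set w | (a <= (e *: (X t - X s)) w)%R] <=
    (expR (- (a ^+ 2 / (4 * D))))%:E)%E.
  move=> e1; rewrite (_ : 4 * D = 2 * (2 * D)); last by ring.
  apply: chernoff_gaussian => //; first by rewrite mulr_gt0.
  set l := a / (2 * D).
  have := hX s t (- (l * e)) (l * e) s0 (ltW st).
  under eq_fun => w.
    rewrite (_ : - (l * e) * X s w + l * e * X t w = l * ((e *: (X t - X s)) w)); last first.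
      have -> : (e *: (X t - X s)) w = e * (X t w - X s w) by []; ring.
    over.
  move=> ->; rewrite lee_fin ler_expR ler_pM2r// sqrrN exprMn e1 mulr1.
  rewrite (_ : _ + _ = l ^+ 2 * (heat_cov R s s - 2 * heat_cov R s t + heat_cov R t t)).
    by apply: ler_wpM2l; [exact: sqr_ge0|exact: heat_cov_increment (ltW st)].
  rewrite [2 * - (l * e) * (l * e)](_ : _ = - (2 * l ^+ 2 * e ^+ 2)); last by ring.
  by rewrite e1; ring.
have mle (f : Omega -> R) : measurable_fun setT f -> measurable [set w | (a <= f w)%R].
  by move=> mf; rewrite -[X in measurable X]setTI; exact: measurable_fun_le.
have m (e : R) : measurable [set w | (a <= (e *: (X t - X s)) w)%R].
  by apply: mle; exact: measurable_funPT.
have e1 : (1 : R) ^+ 2 = 1 by rewrite expr1n.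
have eN1 : (- 1 : R) ^+ 2 = 1 by rewrite sqrrN expr1n.
apply: (@le_trans _ _ (P ([set w | (a <= (1 *: (X t - X s)) w)%R] `|`
                         [set w | (a <= (-1 *: (X t - X s)) w)%R]))).
  apply: le_measure; rewrite ?inE//.
  - apply: mle; apply: measurableT_comp => //.
    exact: measurable_funB.
  - exact: measurableU.
  - move=> w /=; rewrite ler_normr => /orP[aX|aX]; [left|right].
      by rewrite -[X in a <= X]/(1 * (X t w - X s w)) mul1r.
    by rewrite -[X in a <= X]/(-1 * (X t w - X s w)) mulN1r.
apply: (le_trans (measureU2 P (m _) (m _))).
rewrite mulr2n mulrDl mul1r EFinD; apply: leeD; exact: H.
Qed.

End heat_process.

(** * The normalising function *)

Section lil_norm.
Context (R : realType).

Definition lil_norm (t : R) : R := (2 * t / pi) `^ (4^-1) * Num.sqrt (ln (ln t)).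

Lemma heat_cov_gt0 (t : R) : 0 < t -> 0 < heat_cov R t t.
Proof.
move=> t0; rewrite /heat_cov subrr sqrtr0 subr0 divr_gt0// sqrtr_gt0 ?addr_gt0//.
by rewrite mulr_gt0// pi_gt0.
Qed.

(** In this form the Gaussian tail bound at level [c * lil_norm t] becomes [(ln t)^(- c^2)]. *)
Lemma lil_norm_sqr (t : R) : 0 < t -> 0 <= ln (ln t) ->
  lil_norm t ^+ 2 = 2 * heat_cov R t t * ln (ln t).
Proof.
move=> t0 l0; rewrite /lil_norm exprMn sqr_sqrtr//; congr (_ * _).
have p0 : 0 < pi :> R by exact: pi_gt0.
have tp0 : 0 <= 2 * t / pi by rewrite divr_ge0 ?mulr_ge0// ltW.
rewrite -powR_mulrn ?powR_ge0// -powRrM (_ : 4^-1 * 2%:R = 2^-1); last by field.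
rewrite powR12_sqrt// /heat_cov subrr sqrtr0 subr0.
have s0 : 0 <= 2 * (Num.sqrt (t + t) / Num.sqrt (4 * pi)).
  by rewrite mulr_ge0// divr_ge0// sqrtr_ge0.
rewrite -[RHS]ger0_norm// -sqrtr_sqr; congr Num.sqrt.
have tt0 : 0 <= t + t by rewrite addr_ge0 ?(ltW t0).
have p40 : 0 <= 4 * pi :> R by rewrite mulr_ge0// (ltW p0).
rewrite exprMn expr_div_n !sqr_sqrtr//.
(* [field] would unfold [pi] *)
move: (pi : R) p0 {tp0 s0 p40} => p p0.
by field; rewrite gt_eqF.
Qed.

Lemma lil_norm_gt0 (t : R) : 0 < t -> 0 < ln (ln t) -> 0 < lil_norm t.
Proof.
by move=> t0 l0; rewrite mulr_gt0// ?sqrtr_gt0// powR_gt0// divr_gt0 ?mulr_gt0 ?pi_gt0.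
Qed.

Lemma le_lil_norm (s t : R) : 1 < s -> s <= t -> lil_norm s <= lil_norm t.
Proof.
move=> s1 st; have s0 : 0 < s by exact: lt_trans s1.
have t0 : 0 < t by exact: lt_le_trans st.
have p0 : 0 < pi :> R by exact: pi_gt0.
apply: ler_pM; rewrite ?powR_ge0 ?sqrtr_ge0//.
- have h (u : R) : 0 < u -> 0 <= 2 * u / pi by move=> u0; rewrite divr_ge0 ?mulr_ge0 ?(ltW u0) ?(ltW p0)//.
  rewrite ge0_ler_powR ?nnegrE ?h//.
  by rewrite ler_pM2r ?invr_gt0// ler_pM2l.
- rewrite ler_wsqrtr// ler_ln ?posrE ?ln_gt0// ?(lt_le_trans s1)//.
  by rewrite ler_ln ?posrE.
Qed.

End lil_norm.

Section upper_bound.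
Context (R : realType) d (Omega : measurableType d) (P : probability Omega R).
Variables (X : R -> {RV P >-> R}) (hX : heat_process R d Omega P X).

(* Level [j] of the chaining allows increments [g (9/10) ^ j phi], while their
   variance decays like [sqrt 2 ^ (- j)]; since [81/100 sqrt 2 > 11/10], the
   Gaussian exponents grow geometrically and beat the [2 ^ j] terms. *)
Lemma heat_oscillation (T l g lam phi kappa : R) : 0 < T -> 0 < g -> 0 < lam ->
  2 <= kappa -> ln kappa <= 2 * lam ->
  l = (g ^+ 2 / 40) ^+ 2 / 2 * T -> 0 < phi -> phi ^+ 2 = 2 * heat_cov R T T * lam ->
  (P (\bigcup_j \big[setU/set0]_(i < 2 ^ j)
       [set w | (g * (9 / 10) ^+ j * phi <=
         `|X (T + l * i.+1%:R / 2 ^+ j) w - X (T + l * i%:R / 2 ^+ j) w|)%R]) <=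
   (4 * expR (- (2 * ln kappa)))%:E)%E.
Proof.
move=> T0 g0 lam0 k2 kl lE phi0 phi2.
have g20 : 0 < g ^+ 2 by rewrite exprn_gt0.
have gq0 : 0 < g ^+ 2 / 40 by rewrite divr_gt0.
have l0 : 0 < l by rewrite lE mulr_gt0// divr_gt0// exprn_gt0.
pose s (j i : nat) := T + l * i%:R / 2 ^+ j.
have s0 j i : 0 < s j i.
  by rewrite ltr_pwDl// divr_ge0 ?exprn_ge0// mulr_ge0// ltW.
pose E j i := [set w | (g * (9 / 10) ^+ j * phi <= `|X (s j i.+1) w - X (s j i) w|)%R].
have mE j i : measurable (E j i).
  rewrite -[X in measurable X]setTI; apply: measurable_fun_le => //.
  by apply: measurableT_comp => //; exact: measurable_funB.
have lnk0 : 0 < ln kappa by rewrite ln_gt0// (lt_le_trans _ k2)// ltr1n.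
have bern (j : nat) : 1 + j%:R / 10 <= (11 / 10) ^+ j :> R.
  elim: j => [|j IH]; first by rewrite mul0r addr0 expr0.
  rewrite exprS; have : 11 / 10 * (1 + j%:R / 10) <= 11 / 10 * (11 / 10) ^+ j :> R.
    by rewrite ler_pM2l.
  by apply: le_trans; have := ler0n R j; rewrite -natr1; lra.
have PE j i : (P (E j i) <= (2 * (expR (- (2 * ln kappa)) * (4^-1) ^+ j))%:E)%E.
  have a0 : 0 < g * (9 / 10) ^+ j * phi by rewrite !mulr_gt0// exprn_gt0.
  have ss : s j i < s j i.+1.
    by rewrite ltrD2l ltr_pM2r ?invr_gt0 ?exprn_gt0// ltr_pM2l// ltr_nat.
  apply: (le_trans (heat_process_increment R d Omega P X hX (s j i) (s j i.+1) _ (s0 _ _) ss a0)).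
  rewrite lee_fin ler_pM2l//.
  have -> : s j i.+1 - s j i = l / 2 ^+ j by rewrite /s -natr1; ring.
  (* Since [kappa >= 2], a bound [kappa ^ (-2 (j + 1))] leaves a factor [4 ^ (- j)], which absorbs
     the [2 ^ j] increments of level [j]. *)
  have k4 : expR (- (2 * ln kappa)) <= 4^-1.
    rewrite expRN lef_pV2 ?posrE ?expR_gt0// expRM_natl lnK ?posrE; last first.
      by rewrite (lt_le_trans _ k2).
    by have := k2; nra.
  apply: (@le_trans _ _ (expR (- (2 * ln kappa)) * expR (- (2 * ln kappa)) ^+ j)); last first.
    by rewrite ler_pM2l ?expR_gt0// lerXn2r ?nnegrE ?expR_ge0.
  rewrite -exprS -expRM_natl ler_expR mulrN lerN2.
  set u := Num.sqrt (T / 2); set p := Num.sqrt (4 * pi); set m := Num.sqrt 2 : R.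
  have u0 : 0 < u by rewrite sqrtr_gt0 divr_gt0.
  have p0 : 0 < p by rewrite sqrtr_gt0 mulr_gt0// pi_gt0.
  have m0 : 0 < m by rewrite sqrtr_gt0.
  have u2 : u ^+ 2 = T / 2 by rewrite sqr_sqrtr// divr_ge0// ltW.
  have m2 : m ^+ 2 = 2 by rewrite sqr_sqrtr.
  have mj2 : (m ^+ j) ^+ 2 = 2 ^+ j by rewrite -exprM mulnC exprM m2.
  have lsq : Num.sqrt (l / 2 ^+ j) = g ^+ 2 / 40 * u / m ^+ j.
    rewrite -[RHS]ger0_norm -?sqrtr_sqr; last first.
      by rewrite !mulr_ge0 ?invr_ge0 ?exprn_ge0// ltW.
    congr Num.sqrt; rewrite !exprMn !exprVn mj2 u2 lE; field.
    by rewrite gt_eqF// exprn_gt0.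
  have covE : heat_cov R T T = 2 * u / p.
    rewrite /heat_cov subrr sqrtr0 subr0; congr (_ / _).
    rewrite -[RHS]ger0_norm -?sqrtr_sqr; last by rewrite mulr_ge0// ltW.
    by congr Num.sqrt; rewrite exprMn u2; field.
  (* The length [l] is chosen so that [g] cancels from the exponent, leaving the constant 40. *)
  rewrite lsq [leRHS](_ : _ = 40 * lam * (81 / 100 * m) ^+ j); last first.
    have r2 : ((9 / 10) ^+ j) ^+ 2 = (81 / 100) ^+ j :> R.
      by rewrite -exprM mulnC exprM; congr (_ ^+ j); field.
    rewrite exprMn [(g * _) ^+ 2]exprMn r2 phi2 covE [(81 / 100 * m) ^+ j]exprMn.
    set q := (81 / 100) ^+ j; set mj := m ^+ j; field.
    by rewrite !gt_eqF//= ?exprn_gt0.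
  have m14 : 14 / 10 <= m.
    rewrite leNgt; apply/negP => mlt.
    have : m ^+ 2 < 2 by rewrite expr2; nra.
    by rewrite m2 ltxx.
  (* As [ln kappa <= 2 * lam], this is at least [(20 + 2 j) ln kappa], hence at least
     [2 (j + 1) ln kappa]. *)
  apply: (@le_trans _ _ (40 * lam * (1 + j%:R / 10))); last first.
    rewrite ler_pM2l ?mulr_gt0// (le_trans (bern j))//.
    by rewrite lerXn2r ?nnegrE ?mulr_ge0 ?(ltW m0)//; lra.
  by have := ler0n R j; rewrite -natr1; nra.
pose U j := \big[setU/set0]_(i < 2 ^ j) E j i.
have mU j : measurable (U j) by exact: bigsetU_measurable.
have PU j : (P (U j) <= (2 * expR (- (2 * ln kappa)) * (2^-1) ^+ j)%:E)%E.
  apply: (le_trans (Boole_inequality _ _)) => //.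
  apply: (@le_trans _ _ (\sum_(i < 2 ^ j) (2 * (expR (- (2 * ln kappa)) * (4^-1) ^+ j))%:E)%E).
    by apply: lee_sum => i _; exact: PE.
  rewrite sumEFin lee_fin sumr_const card_ord -[_ *+ (2 ^ j)]mulr_natr natrX.
  rewrite le_eqVlt; apply/orP; left; apply/eqP.
  rewrite mulrA -[LHS]mulrA -exprMn; congr (_ * _ ^+ _).
  by field.
apply: (le_trans (generalized_Boole_inequality P mU _)) => //.
  exact: bigcup_measurable.
apply: lime_le; first exact: is_cvg_nneseries.
apply: nearW => n.
apply: (@le_trans _ _ (\sum_(0 <= j < n) (2 * expR (- (2 * ln kappa)) * (2^-1) ^+ j)%:E)%E).
  by apply: lee_sum => j _; exact: PU.
rewrite sumEFin lee_fin.
have := @geometric_le_lim R n (2 * expR (- (2 * ln kappa))) 2^-1.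
rewrite mulr_ge0 ?expR_ge0// invr_gt0 ltr0n ger0_norm// invf_lt1// ltr1n.
move=> /(_ isT isT isT); rewrite /series/=; move/le_trans; apply.
by rewrite le_eqVlt; apply/orP; left; apply/eqP; field.
Qed.

Lemma heat_process_limsup_le (e : R) : 0 < e <= 1 ->
  {ae P, forall w, {within `[0, +oo[, continuous (fun t => X t w)}} ->
  {ae P, forall w, \forall t \near +oo, X t w <= (1 + 2 * e) * lil_norm R t}.
Proof.
move=> /andP[e0 e1] cX.
(* The series of [(9 / 10) ^ j] sums to 10, so the allowed increments add up to at most
   [e * phi k]. *)
pose g := e / 10; have g0 : 0 < g by rewrite divr_gt0.
(* Makes [T k.+1 - T k = dl * T k] the length to which [heat_oscillation] applies. *)
pose dl := (g ^+ 2 / 40) ^+ 2 / 2.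
have dl0 : 0 < dl by rewrite !(divr_gt0, exprn_gt0).
pose th := 1 + dl; have th1 : 1 < th by rewrite ltrDl.
have th0 : 0 < th by exact: lt_trans th1.
pose b := ln th; have b0 : 0 < b by rewrite ln_gt0.
pose T (k : nat) := th ^+ k.
have T0 k : 0 < T k by rewrite exprn_gt0.
have lnT k : ln (T k) = k%:R * b by rewrite lnXn// mulr_natl.
pose phi k := lil_norm R (T k).
(* Since [ln (ln (T k)) = ln k + ln b], the condition [k >= b ^- 2] gives
   [ln k <= 2 * ln (ln (T k))]. *)
pose k0 := maxn 2 (Num.truncn (b ^- 2)).+1.
have k0_2 k : (k0 <= k)%N -> 2 <= k%:R :> R.
  by rewrite geq_max => /andP[? _]; rewrite ler_nat.
have lam k : (k0 <= k)%N -> ln k%:R <= 2 * ln (ln (T k)).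
  move=> kk; have k2 := k0_2 k kk; have kpos : (0 : R) < k%:R by apply: lt_le_trans k2.
  rewrite lnT lnM ?posrE//.
  have : ln (b ^- 2) <= ln k%:R.
    rewrite ler_ln ?posrE// ?invr_gt0 ?exprn_gt0//.
    apply/ltW/(lt_le_trans (truncnS_gt _)); rewrite ler_nat.
    by move: kk; rewrite geq_max => /andP[].
  rewrite lnV ?posrE ?exprn_gt0// lnXn// -mulr_natl; lra.
have lnk0 k : (k0 <= k)%N -> 0 < ln k%:R :> R.
  by move=> /k0_2 k2; rewrite ln_gt0// (lt_le_trans _ k2)// ltr1n.
have lam0 k : (k0 <= k)%N -> 0 < ln (ln (T k)).
  by move=> kk; have := lam k kk; have := lnk0 k kk; lra.
have T1 k : (k0 <= k)%N -> 1 < T k.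
  move=> kk; have := k0_2 k kk; rewrite ler_nat => k2.
  by rewrite exprn_egt1// -lt0n (leq_trans _ k2).
have phi0 k : (k0 <= k)%N -> 0 < phi k by move=> kk; apply: lil_norm_gt0 => //; exact: lam0.
pose B1 k := [set w | ((1 + e) * phi k <= X (T k) w)%R].
pose E k j i := [set w | (g * (9 / 10) ^+ j * phi k <=
  `|X (T k + dl * T k * i.+1%:R / 2 ^+ j) w - X (T k + dl * T k * i%:R / 2 ^+ j) w|)%R].
pose B2 k := \bigcup_j \big[setU/set0]_(i < 2 ^ j) E k j i.
have mle (f : Omega -> R) a : measurable_fun setT f -> measurable [set w | (a <= f w)%R].
  by move=> mf; rewrite -[X in measurable X]setTI; exact: measurable_fun_le.
have mB1 k : measurable (B1 k) by apply: mle.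
have mB2 k : measurable (B2 k).
  apply: bigcup_measurable => j _; apply: bigsetU_measurable => i _.
  by apply: mle; apply: measurableT_comp => //; exact: measurable_funB.
(* Absorbs [b] in [ln (T k) = k b]: [(k b) ^ (- (1 + e)^2) <= C k ^ (- (1 + e))]. *)
pose C := expR ((1 + e) ^+ 2 * `|ln b|).
have PB k : (k0 <= k)%N -> (P (B1 k `|` B2 k) <=
    ((C + 4) * expR (- ((1 + e) * ln k%:R)))%:E)%E.
  move=> kk; apply: (le_trans (measureU2 P (mB1 k) (mB2 k))).
  rewrite mulrDl EFinD; apply: leeD.
    apply: (le_trans (heat_process_tail R d Omega P X hX _ _ (T0 k) _)); first by rewrite mulr_gt0 ?phi0// addr_gt0.
    rewrite lee_fin exprMn (lil_norm_sqr _ _ (T0 k) (ltW (lam0 k kk))).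
    rewrite /C -expRD ler_expR.
    rewrite [leLHS](_ : _ = - ((1 + e) ^+ 2 * ln (ln (T k)))); last first.
      by field; rewrite gt_eqF// heat_cov_gt0.
    have kpos : (0 : R) < k%:R by apply: lt_le_trans (k0_2 k kk).
    rewrite lnT lnM ?posrE//.
    have := lnk0 k kk; have := ler_norm (- ln b); rewrite normrN.
    set L := ln k%:R; set n := `|ln b|; set lb := ln b => H L0.
    have e10 : 0 <= (1 + e) ^+ 2 by exact: sqr_ge0.
    have : (1 + e) * L <= (1 + e) ^+ 2 * L by rewrite ler_pM2r// expr2; nra.
    have : (1 + e) ^+ 2 * (- lb) <= (1 + e) ^+ 2 * n by exact: ler_wpM2l.
    by rewrite mulrDr; lra.
  apply: (le_trans (heat_oscillation (T k) (dl * T k) g (ln (ln (T k))) (phi k) k%:R _ _ _ _ _ _ _ _)) => //.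
  - exact: lam0.
  - exact: k0_2.
  - exact: lam.
  - exact: phi0.
  - by apply: lil_norm_sqr => //; apply/ltW; exact: lam0.
  (* The hypothesis [e <= 1] gives [1 + e <= 2]. *)
  - rewrite lee_fin ler_pM2l// ler_expR lerN2 ler_pM2r ?lnk0//; lra.
pose F n := B1 (n + k0)%N `|` B2 (n + k0)%N.
have mF n : measurable (F n) by exact: measurableU.
have PF : P (lim_sup_set F) = 0.
  apply: lim_sup_set_cvg0 => //.
  apply: (@le_lt_trans _ _ (\sum_(n <oo) ((C + 4)%:E * (expR (- ((1 + e) * ln n.+1%:R)))%:E))%E).
    apply: lee_nneseries => [n _ _ //|n _].
    apply: (le_trans (PB _ (leq_addl _ _))); rewrite -EFinM lee_fin.
    rewrite ler_pM2l ?addr_gt0 ?expR_gt0// ler_expR lerN2 ler_pM2l ?addr_gt0//.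
    rewrite ler_ln ?posrE ?ltr0n ?addn_gt0 ?(leq_trans _ (leq_maxl _ _)) ?orbT// ler_nat.
    by rewrite -addn1 leq_add2l (leq_trans _ (leq_maxl _ _)).
  rewrite nneseriesZl; last by move=> n _; rewrite lee_fin expR_ge0.
  by rewrite lte_mul_pinfty ?lee_fin ?addr_ge0 ?expR_ge0//; exact: pseries_lty.
have : {ae P, forall w, ~ lim_sup_set F w}.
  exists (lim_sup_set F); split => //.
    by apply: bigcap_measurable => // n _; apply: bigcup_measurable => k _.
  by move=> w /= /contrapT.
move: cX; apply: filterS2 => w /continuous_within_itvcyP[cw _] wF.
have [N HN] : exists N, forall n, (N <= n)%N -> ~ F n w.
  apply: contrapT => H; apply: wF => N _.
  move/forallNP : H => /(_ N)/existsNP[n /not_implyP[Nn /contrapT Fn]].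
  by exists n.
have : \forall t \near +oo, T (N + k0)%N < t.
  by exists (T (N + k0)%N); split => //; exact: num_real.
apply: filterS => t Tt.
have [k [kN Tk tk]] : exists k, [/\ (N + k0 <= k)%N, T k <= t & t < T k.+1].
  have [m tm] : exists m, t < T m.
    exists (Num.truncn (t / b)).+1.
    rewrite -[T _]lnK ?posrE// lnT.
    apply: lt_le_trans (expR_ge1Dx _).
    by rewrite ltr_wpDl// -ltr_pdivrMr// truncnS_gt.
  have Nm : (N + k0 <= m)%N.
    by rewrite leqNgt; apply/negP => mN; move: (lt_trans Tt tm); rewrite /T ltr_eXn2l// ltnNge (ltnW mN).
  elim: m Nm tm => [|m IH].
    by rewrite leqn0 => /eqP K0; move: Tt; rewrite K0 => Tt /(lt_trans Tt); rewrite ltxx.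
  rewrite leq_eqVlt => /predU1P[<- /(lt_trans Tt)|]; first by rewrite ltxx.
  rewrite ltnS => Nm tm; have [tTm|Tmt] := ltP t (T m); first exact: IH.
  by exists m.
have kk : (k0 <= k)%N by rewrite (leq_trans _ kN)// leq_addl.
have := HN (k - k0)%N; rewrite leq_subRL// addnC kN => /(_ isT).
rewrite /F subnK// => /not_orP[nB1 nB2].
have osc : `|X t w - X (T k) w| <= e * phi k.
  apply: (@dyadic_chaining R (fun t => X t w) (T k) (dl * T k) _ (fun j => g * (9 / 10) ^+ j * phi k)).
  - exact: mulr_gt0.
  - rewrite Tk/= -[X in X + _]mul1r -mulrDl ltW//.
    by move: tk; rewrite /T exprS.
  - by apply: cw; rewrite in_itv/= andbT (lt_le_trans (T0 k)).
  - move=> j i ij; rewrite leNgt; apply/negP => H; apply: nB2.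
    exists j => //; rewrite -(bigcup_mkord _ (E k j)); exists i => //=; exact: ltW.
  - move=> J; rewrite -mulr_suml -mulr_sumr ler_pM2r ?phi0//.
    have q0 : (0 : R) < 9 / 10 by lra.
    have q1 : `|9 / 10 : R| < 1 by rewrite ger0_norm; lra.
    have := @geometric_le_lim R J 1 (9 / 10) ler01 q0 q1.
    set S := \sum_(i < J) _ => HS.
    have : S <= 1 / (1 - 9 / 10).
      apply: le_trans HS; rewrite /series/= big_mkord.
      by apply: ler_sum => i _; rewrite mul1r.
    rewrite (_ : 1 / (1 - 9 / 10) = 10); last by field.
    by rewrite /g mulrAC ler_pdivrMr// ler_pM2l.
have nX : X (T k) w < (1 + e) * phi k by rewrite ltNge; apply/negP.
have : phi k <= lil_norm R t by apply: le_lil_norm => //; exact: T1.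
have := ler_norm (X t w - X (T k) w).
by have := e0; nra.
Qed.

End upper_bound.

(** * Lower bound *)

Lemma heat_cov_decay (R : realType) (s t : R) : 0 < s -> s <= t ->
  heat_cov R s t ^+ 2 <= 2 * s / t * (heat_cov R s s * heat_cov R t t).
Proof.
move=> s0 st; have t0 : 0 < t by exact: lt_le_trans st.
rewrite /heat_cov !subrr sqrtr0 !subr0.
have p0 : 0 < Num.sqrt (4 * pi) :> R by rewrite sqrtr_gt0 mulr_gt0// pi_gt0.
move: (Num.sqrt (4 * pi)) p0 => p p0.
set x := Num.sqrt (s + t); set y := Num.sqrt (t - s).
set u := Num.sqrt (s + s); set v := Num.sqrt (t + t).
have x0 : 0 < x by rewrite sqrtr_gt0 addr_gt0.
have y0 : 0 <= y by exact: sqrtr_ge0.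
have u0 : 0 < u by rewrite sqrtr_gt0 addr_gt0.
have v0 : 0 < v by rewrite sqrtr_gt0 addr_gt0.
have xE : x ^+ 2 = s + t by rewrite sqr_sqrtr// addr_ge0// ltW.
have yE : y ^+ 2 = t - s by rewrite sqr_sqrtr// subr_ge0.
have uE : u ^+ 2 = s + s by rewrite sqr_sqrtr// addr_ge0// ltW.
have vE : v ^+ 2 = t + t by rewrite sqr_sqrtr// addr_ge0// ltW.
have yx : y <= x by rewrite ler_wsqrtr//; lra.
have uv : u <= v by rewrite ler_wsqrtr//; lra.
rewrite expr_div_n (_ : 2 * s / t * (u / p * (v / p)) = 2 * s / t * (u * v) / p ^+ 2); last first.
  by field; rewrite !gt_eqF.
rewrite ler_pM2r ?invr_gt0 ?exprn_gt0//.
(* [x - y = 2 s / (x + y)] and [s <= u v / 2] *)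
have h1 : (x - y) * x <= 2 * s by nra.
have h2 : (x - y) ^+ 2 * t <= 4 * s ^+ 2.
  apply: (@le_trans _ _ (((x - y) * x) ^+ 2)).
    by rewrite exprMn ler_wpM2l ?sqr_ge0// xE lerDr ltW.
  have -> : 4 * s ^+ 2 = (2 * s) ^+ 2 by rewrite exprMn; congr (_ * _); ring.
  by rewrite lerXn2r ?nnegrE ?mulr_ge0 ?subr_ge0 ?(ltW s0) ?(ltW x0).
rewrite -(ler_pM2r t0) (_ : 2 * s / t * (u * v) * t = 2 * s * (u * v)); last by field; rewrite gt_eqF.
rewrite (le_trans h2)//.
have : u * u <= u * v by rewrite ler_pM2l.
by rewrite -expr2 uE; nra.
Qed.

(* Integrated, this is Chebyshev's inequality for the mean of the restricted
   weights [F k] on [I k]: it comes from [c <= (S / n - 1) ^ 2] with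
   [S = \sum_(k | I k) F k], and [A], [B] are Markov-type bounds of the
   indicators of the two sides of the window. *)
Lemma second_moment_pointwise (R : realType) (n : nat) (F A B : 'I_n -> R)
    (I : 'I_n -> bool) (D : R) (c : bool) :
  (0 < n)%N -> (forall k, 0 <= F k) -> (forall k, 0 <= A k) -> (forall k, 0 <= B k) ->
  0 <= D -> (forall k, I k -> F k <= D) -> (forall k, ~~ I k -> 1 <= A k + B k) ->
  (c -> forall k, ~~ I k) ->
  c%:R + 2 / n%:R * (\sum_k F k) <=
  (\sum_j \sum_k (if j == k then D * F k else F j * F k)) / n%:R ^+ 2 + 1 +
  2 / n%:R * (\sum_k F k * (A k + B k)).
Proof.
move=> n0 F0 A0 B0 D0 FD AB cI.
have N0 : 0 < n%:R :> R by rewrite ltr0n.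
pose U k := if I k then F k else 0.
have U0 k : 0 <= U k by rewrite /U; case: ifP.
have UF k : U k <= F k by rewrite /U; case: ifP.
(* On the diagonal one factor is bounded by [D], so no second moment of a single [F k] will
   appear. *)
have h1 : (\sum_k U k) ^+ 2 <= \sum_j \sum_k (if j == k then D * F k else F j * F k).
  rewrite expr2 big_distrlr/=; apply: ler_sum => j _; apply: ler_sum => k _.
  case: eqP => [->|_]; last exact: ler_pM.
  by apply: ler_pM => //; rewrite /U; case: ifP => // /FD.
have h2 : \sum_k F k <= \sum_k U k + \sum_k F k * (A k + B k).
  rewrite -big_split/=; apply: ler_sum => k _; rewrite /U; case: ifPn => [Ik|nI].
    by rewrite lerDl mulr_ge0// addr_ge0.
  by rewrite add0r ler_peMr// AB.
set S := \sum_k U k in h1 h2; set W := \sum_k F k in h2 *.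
set Q := \sum_k F k * (A k + B k) in h2 *; set M := \sum_j _ in h1 *.
have h3 : c%:R <= (S / n%:R - 1) ^+ 2.
  case: c cI => /= [/(_ isT) nI|_]; last exact: sqr_ge0.
  rewrite (_ : S = 0) ?mul0r ?sub0r ?sqrrN ?expr1n//.
  by rewrite /S big1// => k _; rewrite /U (negPf (nI k)).
apply: (@le_trans _ _ ((S / n%:R - 1) ^+ 2 + 2 / n%:R * (S + Q))).
  by apply: lerD => //; rewrite ler_pM2l ?divr_gt0.
rewrite mulrDr addrA lerD2r.
have -> : (S / n%:R - 1) ^+ 2 + 2 / n%:R * S = S ^+ 2 / n%:R ^+ 2 + 1 by field; rewrite gt_eqF.
by rewrite lerD2r ler_pM2r// invr_gt0 exprn_gt0.
Qed.

Section second_moment.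
Context (R : realType) d (Omega : measurableType d) (P : probability Omega R).
Variables (X : R -> {RV P >-> R}) (hX : heat_process R d Omega P X).

(** The three terms come from the diagonal of the second moment, from the excess over 1 of the
    off-diagonal terms, and from the tilted mass outside the window, which enters through the cross
    term of the square. *)
Lemma heat_process_window (n : nat) (e : R) : (2 <= n)%N -> 0 < e < 4^-1 ->
  (P (\bigcap_(k < n) [set w | (X (n%:R ^+ k.+1) w <=
        (1 - 3 * e) * Num.sqrt (2 * ln n%:R) *
         Num.sqrt (heat_cov R (n%:R ^+ k.+1) (n%:R ^+ k.+1)))%R]) <=
   (expR (- (2 * e * ln n%:R)) +
    (expR (2 * ln n%:R * Num.sqrt (2 / n%:R)) - 1) +
    4 * expR (- (e ^+ 2 * ln n%:R)))%:E)%E.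
Proof.
move=> n2 /andP[e0 e4].
have N1 : 1 < n%:R :> R by rewrite ltr1n.
have N0 : 0 < n%:R :> R by exact: lt_trans N1.
have L0 : 0 < ln n%:R :> R by rewrite ln_gt0.
set L := ln n%:R : R in L0 *; set x := Num.sqrt (2 * L).
have x0 : 0 < x by rewrite sqrtr_gt0 mulr_gt0.
have x2 : x ^+ 2 = 2 * L by rewrite sqr_sqrtr// mulr_ge0// ltW.
pose tau (k : nat) : R := n%:R ^+ k.+1.
have tau0 k : 0 < tau k by rewrite exprn_gt0.
pose sg k := Num.sqrt (heat_cov R (tau k) (tau k)).
have V0 k : 0 < heat_cov R (tau k) (tau k) by exact: heat_cov_gt0.
have sg0 k : 0 < sg k by rewrite sqrtr_gt0.
have sg2 k : sg k ^+ 2 = heat_cov R (tau k) (tau k) by rewrite sqr_sqrtr// ltW.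
pose a := (1 - 3 * e) * x; pose beta := (1 - 2 * e) * x; pose b := (1 - e) * x.
(* Half the width of the window, and also the optimal Chernoff parameter: under the tilted law [G k]
   has mean [beta] and variance 1, so [A k] and [B k] both have mean [expR (- mu ^+ 2 / 2)]. *)
pose mu := e * x.
have mu0 : 0 < mu by rewrite mulr_gt0.
pose G (k : nat) w := X (tau k) w / sg k.
pose F (k : nat) w := expR (beta * G k w - beta ^+ 2 / 2).
pose A (k : nat) w := expR (mu * (a - G k w)).
pose B (k : nat) w := expR (mu * (G k w - b)).
pose D := expR (beta * b - beta ^+ 2 / 2).
pose eta := 2 * L * Num.sqrt (2 / n%:R).
have mG k : measurable_fun setT (G k) by apply: measurable_funM.
have mF k : measurable_fun setT (F k).
  by apply: measurableT_comp => //; apply: measurable_funB => //; exact: measurable_funM.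
have mA k : measurable_fun setT (A k).
  by apply: measurableT_comp => //; apply: measurable_funM => //; exact: measurable_funB.
have mB k : measurable_fun setT (B k).
  by apply: measurableT_comp => //; apply: measurable_funM => //; exact: measurable_funB.
have E1 (l c : R) k : (\int[P]_w (expR (l * G k w + c))%:E = (expR (l ^+ 2 / 2 + c))%:E)%E.
  have := hX (tau k) (tau k) 0 (l / sg k) (tau0 k) (lexx _).
  rewrite unlock expr0n/= mulr0 !mul0r !add0r expr_div_n -sg2 divfK ?gt_eqF ?exprn_gt0// => H.
  rewrite expRD EFinM -H -ge0_integralZr//; last first.
    by apply/measurable_EFinP; apply: measurableT_comp => //; apply: measurable_funD; exact: measurable_funM.
  apply: eq_integral => w _; rewrite -EFinM -expRD mul0r add0r /G.
  by rewrite (_ : l * (X (tau k) w / sg k) = l / sg k * X (tau k) w)// mulrA mulrAC.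
have EF k : (\int[P]_w (F k w)%:E = 1)%E.
  by rewrite /F E1 subrr expR0.
have eL : e ^+ 2 * L = e ^+ 2 * x ^+ 2 / 2 by rewrite x2; field.
have EFA k : (\int[P]_w (F k w * A k w)%:E = (expR (- (e ^+ 2 * L)))%:E)%E.
  rewrite (eq_integral (fun w => (expR ((beta - mu) * G k w + (mu * a - beta ^+ 2 / 2)))%:E)); last first.
    by move=> w _; rewrite /F /A -expRD; congr (expR _)%:E; ring.
  by rewrite E1 eL; congr (expR _)%:E; rewrite /beta /mu /a; field.
have EFB k : (\int[P]_w (F k w * B k w)%:E = (expR (- (e ^+ 2 * L)))%:E)%E.
  rewrite (eq_integral (fun w => (expR ((beta + mu) * G k w + (- (mu * b) - beta ^+ 2 / 2)))%:E)); last first.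
    by move=> w _; rewrite /F /B -expRD; congr (expR _)%:E; ring.
  by rewrite E1 eL; congr (expR _)%:E; rewrite /beta /mu /b; field.
have EFF j k : (j < k)%N -> (\int[P]_w (F j w * F k w)%:E <= (expR eta)%:E)%E.
  move=> jk; have tjk : tau j <= tau k by rewrite ler_eXn2l// ltnS ltnW.
  have := hX (tau j) (tau k) (beta / sg j) (beta / sg k) (tau0 j) tjk; rewrite unlock => H.
  have -> : (\int[P]_w (F j w * F k w)%:E = \int[P]_w
      ((expR (- beta ^+ 2))%:E * (expR (beta / sg j * X (tau j) w + beta / sg k * X (tau k) w))%:E))%E.
    apply: eq_integral => w _; rewrite -EFinM /F -!expRD /G; congr (expR _)%:E.
    by field; rewrite !gt_eqF.
  rewrite ge0_integralZl_EFin ?expR_ge0//; last first.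
    apply/measurable_EFinP; apply: measurableT_comp => //.
    by apply: measurable_funD; exact: measurable_funM.
  rewrite H -EFinM -expRD lee_fin ler_expR -!sg2.
  set K := heat_cov R (tau j) (tau k).
  rewrite [leLHS](_ : _ = beta ^+ 2 * (K / (sg j * sg k))); last by field; rewrite !gt_eqF.
  have sjk : 0 < sg j * sg k by rewrite mulr_gt0.
  apply: (@le_trans _ _ (beta ^+ 2 * Num.sqrt (2 / n%:R))).
    rewrite ler_wpM2l ?sqr_ge0// ler_pdivrMr//.
    apply: le_trans (ler_norm _) _; rewrite -sqrtr_sqr.
    rewrite -[sg j * sg k]gtr0_norm// -sqrtr_sqr -sqrtrM ?divr_ge0//.
    rewrite ler_wsqrtr// (le_trans (heat_cov_decay _ _ _ (tau0 j) tjk))// exprMn !sg2.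
    rewrite ler_wpM2r ?(ltW (mulr_gt0 (V0 j) (V0 k)))//.
    rewrite ler_pdivrMr// -mulrA ler_pM2l// ler_pdivlMl// /tau -exprS ler_eXn2l//.
  rewrite /eta ler_wpM2r ?sqrtr_ge0// exprMn -x2 ler_piMl ?sqr_ge0//.
  by rewrite exprn_ile1//; lra.
(* The unrestricted [F k ^+ 2] has mean [expR (beta ^+ 2)], which exceeds [n] for small [e]; [D] is
   only [n] to the power [1 - 2 * e]. *)
pose M (j k : 'I_n) w := if j == k then D * F k w else F j w * F k w.
have EM j k : (\int[P]_w (M j k w)%:E <= (if j == k then D else expR eta)%:E)%E.
  rewrite /M; case: eqP => [_|/eqP jk].
    under eq_integral do rewrite EFinM.
    rewrite ge0_integralZl_EFin ?expR_ge0//.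
    - by rewrite EF mule1.
    - by move=> w _; rewrite lee_fin expR_ge0.
    - exact/measurable_EFinP.
  case: (ltngtP j k) => [|kj|/val_inj]; [exact: EFF| |by move=> h; rewrite h eqxx in jk].
  by under eq_integral do rewrite mulrC; exact: EFF.
have mM j k : measurable_fun setT (M j k).
  by rewrite /M; case: eqP => _; exact: measurable_funM.
set W := \bigcap_(k < n) _.
have mW : measurable W.
  apply: bigcap_measurable => [|k _]; first by exists 0%N; exact: leq_trans n2.
  by rewrite -[X in measurable X]setTI; exact: measurable_fun_le.
have NM : (n%:R : R) != 0 by rewrite gt_eqF.
have pw w : ((w \in W)%:R + 2 / n%:R * (\sum_(k < n) F k w) <=
   (\sum_j \sum_k M j k w) / n%:R ^+ 2 + 1 +
   2 / n%:R * (\sum_(k < n) (F k w * A k w + F k w * B k w))).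
  under [X in _ <= _ + _ * X]eq_bigr do rewrite -mulrDr.
  apply: (@second_moment_pointwise R n (fun k => F k w) (fun k => A k w) (fun k => B k w)
    (fun k => (a < G k w) && (G k w <= b)) D) => //.
  - exact: leq_trans n2.
  - by move=> k; exact: expR_ge0.
  - by move=> k; exact: expR_ge0.
  - by move=> k; exact: expR_ge0.
  - exact: expR_ge0.
  - move=> k /andP[_ Gb]; rewrite ler_expR lerD2r ler_wpM2l//.
    by rewrite mulr_ge0 ?(ltW x0)//; lra.
  - move=> k; rewrite negb_and -leNgt -ltNge => /orP[Ga|Gb].
      apply: (@le_trans _ _ (A k w)); last by rewrite lerDl expR_ge0.
      by rewrite -expR0 ler_expR mulr_ge0 ?(ltW mu0)// subr_ge0.
    apply: (@le_trans _ _ (B k w)); last by rewrite lerDr expR_ge0.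
    by rewrite -expR0 ler_expR mulr_ge0 ?(ltW mu0)// subr_ge0 ltW.
  - move=> /set_mem Ww k; rewrite negb_and -leNgt; apply/orP; left.
    by rewrite ler_pdivrMr//; exact: (Ww k (ltn_ord k)).
have mEF k : measurable_fun setT (fun w => (F k w)%:E) by exact/measurable_EFinP.
have sumI (I : finType) (f : I -> Omega -> R) : (forall i, measurable_fun setT (f i)) ->
    (forall i w, 0 <= f i w) ->
    (\int[P]_w (\sum_i f i w)%:E = \sum_i \int[P]_w (f i w)%:E)%E.
  move=> mf f0; under eq_integral do rewrite -sumEFin.
  rewrite ge0_integral_sum//.
  - by move=> i; exact/measurable_EFinP.
  - by move=> i w _; rewrite lee_fin.
have addI (f g : Omega -> R) : measurable_fun setT f -> measurable_fun setT g ->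
    (forall w, 0 <= f w) -> (forall w, 0 <= g w) ->
    (\int[P]_w (f w + g w)%:E = \int[P]_w (f w)%:E + \int[P]_w (g w)%:E)%E.
  move=> mf mg f0 g0; under eq_integral do rewrite EFinD.
  rewrite ge0_integralD//; try exact/measurable_EFinP.
  - by move=> w _; rewrite lee_fin.
  - by move=> w _; rewrite lee_fin.
have scI (r : R) (f : Omega -> R) : measurable_fun setT f -> 0 <= r -> (forall w, 0 <= f w) ->
    (\int[P]_w (r * f w)%:E = r%:E * \int[P]_w (f w)%:E)%E.
  move=> mf r0 f0; under eq_integral do rewrite EFinM.
  rewrite ge0_integralZl_EFin//; last exact/measurable_EFinP.
  by move=> w _; rewrite lee_fin.
have msum (I : finType) (f : I -> Omega -> R) : (forall i, measurable_fun setT (f i)) ->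
    measurable_fun setT (fun w => \sum_i f i w).
  by move=> mf; exact: measurable_sum.
have F0 k w : 0 <= F k w by exact: expR_ge0.
have M0 j k w : 0 <= M j k w by rewrite /M; case: ifP => _; rewrite mulr_ge0 ?expR_ge0.
have FA0 k w : 0 <= F k w * A k w by rewrite mulr_ge0 ?expR_ge0.
have FB0 k w : 0 <= F k w * B k w by rewrite mulr_ge0 ?expR_ge0.
have twon : 0 <= 2 / n%:R :> R by rewrite divr_ge0.
have mFA k : measurable_fun setT (fun w => F k w * A k w) by exact: measurable_funM.
have mFB k : measurable_fun setT (fun w => F k w * B k w) by exact: measurable_funM.
have lhsE : (\int[P]_w ((w \in W)%:R + 2 / n%:R * (\sum_(k < n) F k w))%:E = P W + 2%:E)%E.
  have mi : measurable_fun setT (fun w => (w \in W)%:R : R) by exact: (measurable_indic mW).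
  rewrite addI//; last 2 first.
  - by apply: measurable_funM => //; exact: msum.
  - by move=> w; rewrite mulr_ge0// sumr_ge0.
  rewrite scI//; [|exact: msum|by move=> w; rewrite sumr_ge0].
  rewrite sumI// (eq_bigr (fun=> 1%E)) => [|i _]; last exact: EF.
  have <- : (\int[P]_w ((w \in W)%:R)%:E = P W)%E.
    by have := integral_indic P measurableT mW; rewrite setIT.
  by rewrite sumEFin sumr_const card_ord -EFinM divfK.
have rhsE : (\int[P]_w ((\sum_j \sum_k M j k w) / n%:R ^+ 2 + 1 +
   2 / n%:R * (\sum_(k < n) (F k w * A k w + F k w * B k w)))%:E <=
   (D / n%:R + expR eta + 1 + 4 * expR (- (e ^+ 2 * L)))%:E)%E.
  have mMM : measurable_fun setT (fun w => \sum_j \sum_k M j k w).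
    by apply: (msum _ (fun j w => \sum_k M j k w)) => j; exact: msum.
  have mFAB : measurable_fun setT (fun w => \sum_(k < n) (F k w * A k w + F k w * B k w)).
    by apply: (msum _ (fun (k : 'I_n) w => F k w * A k w + F k w * B k w)) => k; exact: measurable_funD.
  have MM0 w : 0 <= \sum_j \sum_k M j k w by apply: sumr_ge0 => j _; exact: sumr_ge0.
  have FAB0 w : 0 <= \sum_(k < n) (F k w * A k w + F k w * B k w).
    by apply: sumr_ge0 => k _; exact: addr_ge0.
  have ni0 : 0 <= (n%:R ^+ 2)^-1 :> R by rewrite invr_ge0 exprn_ge0.
  under eq_integral => w _ do rewrite [(\sum_j _) / _]mulrC.
  rewrite (addI (fun w => (n%:R ^+ 2)^-1 * (\sum_j \sum_k M j k w) + 1)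
    (fun w => 2 / n%:R * (\sum_(k < n) (F k w * A k w + F k w * B k w)))); last 4 first.
  - by apply: measurable_funD => //; exact: measurable_funM.
  - exact: measurable_funM.
  - by move=> w; rewrite addr_ge0// mulr_ge0.
  - by move=> w; rewrite mulr_ge0.
  rewrite (addI (fun w => (n%:R ^+ 2)^-1 * (\sum_j \sum_k M j k w)) (cst 1)); last 4 first.
  - exact: measurable_funM.
  - exact: measurable_cst.
  - by move=> w; rewrite mulr_ge0.
  - by [].
  have I1 : (\int[P]_w (cst (1 : R) w)%:E = 1)%E.
    transitivity (\int[P]_(w in setT) (cst 1%E w))%E => //.
    by rewrite integral_cst//= (@probability_setT _ _ _ P) mule1.
  rewrite !scI// I1.
  rewrite (sumI _ (fun j w => \sum_k M j k w)); last 2 first.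
  - by move=> j; exact: msum.
  - by move=> j w; exact: sumr_ge0.
  rewrite (sumI _ (fun (k : 'I_n) w => F k w * A k w + F k w * B k w)); last 2 first.
  - by move=> k; exact: measurable_funD.
  - by move=> k w; exact: addr_ge0.
  under [X in (_ + _ * X)%E]eq_bigr => k _.
    rewrite (addI (fun w => F k w * A k w) (fun w => F k w * B k w))// EFA EFB -EFinD; over.
  rewrite sumEFin sumr_const card_ord.
  have SM : (\sum_j \int[P]_w (\sum_k M j k w)%:E <=
      (n%:R * D + n%:R ^+ 2 * expR eta)%:E)%E.
    apply: (@le_trans _ _ (\sum_(j < n) (D + n%:R * expR eta)%:E)%E); last first.
      rewrite sumEFin lee_fin sumr_const card_ord -[_ *+ n]mulr_natl mulrDr.
      by rewrite mulrA -expr2.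
    apply: lee_sum => j _; rewrite (sumI _ (fun k w => M j k w))//.
    apply: (@le_trans _ _ (\sum_(k < n) ((if k == j then D else 0) + expR eta)%:E)%E).
      apply: lee_sum => k _; apply: (le_trans (EM j k)).
      rewrite lee_fin eq_sym; case: eqP => _; first by rewrite lerDl expR_ge0.
      by rewrite add0r.
    rewrite sumEFin lee_fin big_split/= -big_mkcond/= big_pred1_eq.
    by rewrite sumr_const card_ord -[_ *+ n]mulr_natl.
  apply: (@le_trans _ _ (((n%:R ^+ 2)^-1)%:E * (n%:R * D + n%:R ^+ 2 * expR eta)%:E + 1 +
     (2 / n%:R)%:E * ((expR (- (e ^+ 2 * L)) + expR (- (e ^+ 2 * L))) *+ n)%:E)%E).
    by rewrite leeD2r// leeD2r// lee_wpmul2l// lee_fin.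
  rewrite -!EFinM -!EFinD lee_fin -[_ *+ n]mulr_natl.
  by rewrite le_eqVlt; apply/orP; left; apply/eqP; field.
have : (P W + 2%:E <= (D / n%:R + expR eta + 1 + 4 * expR (- (e ^+ 2 * L)))%:E)%E.
  rewrite -lhsE; apply: le_trans rhsE; apply: ge0_le_integral => //.
  - by move=> w _; rewrite lee_fin addr_ge0// mulr_ge0// sumr_ge0.
  - apply/measurable_EFinP; apply: measurable_funD; first exact: (measurable_indic mW).
    by apply: measurable_funM => //; exact: msum.
  - apply/measurable_EFinP; apply: measurable_funD; last first.
      apply: measurable_funM => //.
      by apply: (msum _ (fun (k : 'I_n) w => F k w * A k w + F k w * B k w)) => k; exact: measurable_funD.
    apply: measurable_funD => //; apply: measurable_funM => //.
    by apply: (msum _ (fun j w => \sum_k M j k w)) => j; exact: msum.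
  - by move=> w _; rewrite lee_fin pw.
have DN : D / n%:R = expR (- (2 * e * L)).
  have {1}-> : n%:R = expR L :> R by rewrite lnK ?posrE.
  rewrite /D -expRN -expRD; congr expR; rewrite /beta /b.
  rewrite [X in _ = X](_ : _ = (1 - 2 * e) / 2 * (2 * L) - L); last by field.
  by rewrite -x2; field.
rewrite DN -(fineK (fin_num_measure P W mW)) -EFinD !lee_fin.
rewrite -/eta; move: (fine (P W)) (expR (- (2 * e * L))) (expR eta) (expR (- (e ^+ 2 * L))).
by move=> p1 p2 p3 p4; clear; lra.
Qed.

End second_moment.

Section lower_bound.
Context (R : realType) d (Omega : measurableType d) (P : probability Omega R).
Variables (X : R -> {RV P >-> R}) (hX : heat_process R d Omega P X).

(** Only convergence to 0 matters, so the terms are bounded crudely: [expR (- z) <= z^-1] for two of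
    them, and [expR v - 1 <= 2 * v] for [v <= 2^-1] for the other. The threshold 48 makes [24 / y]
    at most [2^-1]. *)
Lemma heat_process_window_ln (n : nat) (e : R) : 0 < e < 4^-1 -> 48 <= ln (n%:R : R) ->
  (P (\bigcap_(k < n) [set w | (X (n%:R ^+ k.+1) w <=
        (1 - 3 * e) * Num.sqrt (2 * ln n%:R) *
         Num.sqrt (heat_cov R (n%:R ^+ k.+1) (n%:R ^+ k.+1)))%R]) <=
   ((48 + (2 * e)^-1 + 4 / e ^+ 2) / ln n%:R)%:E)%E.
Proof.
move=> e04 y48; have /andP[e0 _] := e04.
have n2 : (2 <= n)%N.
  case: n y48 => [|[|n //]]; first by rewrite ln0// ; lra.
  by rewrite ln1; lra.
apply: (le_trans (heat_process_window R d Omega P X hX n e n2 e04)); rewrite lee_fin.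
have n0 : 0 < n%:R :> R by rewrite ltr0n (leq_trans _ n2).
set y := ln n%:R in y48 *.
have y0 : 0 < y by lra.
have einv (z : R) : 0 < z -> expR (- z) <= z^-1.
  move=> z0; rewrite expRN lef_pV2 ?posrE ?expR_gt0//.
  by apply: le_trans (expR_ge1Dx z); rewrite lerDr.
set v := 2 * y * Num.sqrt (2 / n%:R).
have v24 : v <= 24 / y.
  rewrite ler_pdivlMr// /v.
  rewrite -(@ler_pXn2r _ 2)// ?nnegrE ?mulr_ge0 ?sqrtr_ge0 ?(ltW y0)//.
  rewrite exprMn [(2 * y * _) ^+ 2]exprMn sqr_sqrtr ?divr_ge0//.
  (* From [n = expR (y / 2) ^+ 2] and [expR u >= u ^+ 2 / 2]. As [v ^+ 2 = 8 y^2 / n], the constant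
     24 works because [8 * 64 <= 24 ^ 2]. *)
  have ny : (y ^+ 2 / 8) ^+ 2 <= n%:R.
    rewrite -[leRHS]lnK ?posrE// -/y (_ : y = (y / 2) * 2%:R); last by field.
    rewrite expRM_natr lerXn2r ?nnegrE ?expR_ge0//.
      by rewrite divr_ge0// exprn_ge0// mulr_ge0// divr_ge0// ltW.
    have := @expR_ge1Dxn R (y / 2) 1 _; rewrite divr_ge0 ?(ltW y0)// => /(_ isT).
    apply: le_trans; rewrite -[2`!]/2%N (_ : y / 2 * 2%:R = y); last by field.
    by rewrite expr_div_n; lra.
  rewrite [leLHS](_ : _ = 8 * y ^+ 4 / n%:R); last by field; rewrite gt_eqF.
  rewrite ler_pdivrMr//.
  have : 24 ^+ 2 * (y ^+ 2 / 8) ^+ 2 <= 24 ^+ 2 * n%:R by rewrite ler_pM2l.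
  apply: le_trans; rewrite [leRHS](_ : _ = 9 * y ^+ 4); last by field.
  by rewrite ler_pM2r ?exprn_gt0// ler_nat.
have v0 : 0 <= v by rewrite !mulr_ge0 ?sqrtr_ge0// ltW.
have vh : v <= 2^-1 by apply: (le_trans v24); rewrite ler_pdivrMr//; lra.
have ev : expR v - 1 <= 48 / y.
  apply: (@le_trans _ _ (2 * v)); last by move: v24; lra.
  have : (1 - v) * expR v <= 1.
    have := expR_ge1Dx (- v); rewrite -(ler_pM2r (expR_gt0 v)) -expRD addNr expR0.
    by [].
  by have := expR_gt0 v; nra.
have h1 : expR (- (2 * e * y)) <= (2 * e)^-1 / y by rewrite -invfM einv// !mulr_gt0.
have h2 : 4 * expR (- (e ^+ 2 * y)) <= 4 / e ^+ 2 / y.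
  by rewrite -[leRHS]mulrA ler_pM2l// -invfM einv// mulr_gt0// exprn_gt0.
rewrite [leRHS](_ : _ = (2 * e)^-1 / y + 48 / y + 4 / e ^+ 2 / y); last by ring.
by rewrite !lerD.
Qed.

(** If the conclusion fails for [w], then [w] lies in [W n] for all large [n], hence in some [B m];
    each [B m] is null, being contained in events [W n] of arbitrarily small probability. Passing
    from [1 - 3 * e] to [1 - 4 * e] pays for the factor [1 + e] between the two normalisations, as
    [(1 - 4 e) (1 + e) <= 1 - 3 e]. *)
Lemma heat_process_limsup_ge (e : R) : 0 < e < 4^-1 ->
  {ae P, forall w, forall T : R, exists2 t, T < t & (1 - 4 * e) * lil_norm R t < X t w}.
Proof.
move=> e04; have /andP[e0 e4] := e04.
pose W (n : nat) := \bigcap_(k < n) [set w | (X (n%:R ^+ k.+1) w <=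
        (1 - 3 * e) * Num.sqrt (2 * ln n%:R) *
         Num.sqrt (heat_cov R (n%:R ^+ k.+1) (n%:R ^+ k.+1)))%R].
(* The term 48 serves [heat_process_window_ln]; [e ^- 2] gives [1 <= e ^+ 2 * ln n], from which
   [ln (ln n) <= 2 * e * ln n] follows. *)
pose n0 := (Num.truncn (expR (48 + e ^- 2))).+1.
have ln_large (A : R) n : (Num.truncn (expR A) < n)%N -> A <= ln n%:R.
  move=> An; rewrite -[leLHS]expRK ler_ln ?posrE ?expR_gt0//.
    by apply/ltW/(lt_le_trans (truncnS_gt _)); rewrite ler_nat.
  by rewrite ltr0n (leq_ltn_trans _ An).
have lnn0 n : (n0 <= n)%N -> 48 + e ^- 2 <= ln n%:R by move=> /ln_large.
have ie2 : 0 < e ^- 2 by rewrite invr_gt0 exprn_gt0.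
have mW n : (n0 <= n)%N -> measurable (W n).
  move=> nn; apply: bigcap_measurable => [|k _]; first by exists 0%N; exact: leq_trans nn.
  by rewrite -[X in measurable X]setTI; exact: measurable_fun_le.
pose C := 48 + (2 * e)^-1 + 4 / e ^+ 2.
have C0 : 0 < C by rewrite !addr_gt0// ?invr_gt0 ?mulr_gt0// divr_gt0// exprn_gt0.
pose B (m : nat) := \bigcap_i W (i + m + n0)%N.
have mB m : measurable (B m).
  by apply: bigcapT_measurable => i; apply: mW; exact: leq_addl.
have PB m : P (B m) = 0.
  apply/eqP; rewrite eq_le measure_ge0 andbT; apply/lee_addgt0Pr => h h0.
  rewrite add0e.
  pose i := (Num.truncn (expR (C / h))).+1.
  apply: (@le_trans _ _ (P (W (i + m + n0)%N))).
    apply: le_measure; rewrite ?inE//; first by apply: mW; exact: leq_addl.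
    by move=> w; apply.
  have y48 : 48 <= ln ((i + m + n0)%:R : R).
    by apply: le_trans (lnn0 _ (leq_addl _ _)); rewrite lerDl ltW.
  apply: (le_trans (heat_process_window_ln _ _ e04 y48)).
  rewrite lee_fin -/C ler_pdivrMr; last by apply: lt_le_trans y48.
  rewrite mulrC -ler_pdivrMr//; apply: ln_large.
  by rewrite -addnA -/i ltn_addr.
exists (\bigcup_m B m); split.
- exact: bigcup_measurable.
- apply/eqP; rewrite eq_le measure_ge0 andbT.
  apply: (le_trans (generalized_Boole_inequality P mB _)); first exact: bigcup_measurable.
  by rewrite eseries0// => i _ _; exact: PB.
move=> w /= /existsNP[T wT].
have XT t : T < t -> X t w <= (1 - 4 * e) * lil_norm R t.
  by move=> Tt; rewrite leNgt; apply/negP => H; by apply: wT; exists t.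
(* From this index on [n > T], so all the times [n ^ k.+1] lie beyond [T]. *)
exists (Num.truncn `|T|).+1 => // i _ /= k kn.
set n := (i + _ + n0)%N in kn *.
have nT : T < n%:R.
  apply: (le_lt_trans (ler_norm _)); apply: (lt_le_trans (truncnS_gt _)).
  by rewrite ler_nat /n addnAC leq_addl.
have yn := lnn0 n (leq_addl _ _).
have y1 : 1 <= ln (n%:R : R) by lra.
have y0 : 0 < ln (n%:R : R) by lra.
have n1 : 1 <= n%:R :> R by rewrite ler1n (leq_trans _ kn).
have N0 : 0 < n%:R :> R by exact: lt_le_trans n1.
set t := n%:R ^+ k.+1.
have t0 : 0 < t by rewrite exprn_gt0.
have nt : n%:R <= t by rewrite /t exprS ler_peMr ?(ltW N0)// exprn_ege1.
apply: (le_trans (XT t (lt_le_trans nT nt))).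
have lt : ln t = k.+1%:R * ln n%:R by rewrite lnXn// mulr_natl.
have lt1 : 1 <= ln t.
  have k1 : 1 <= k.+1%:R :> R by rewrite ler1n.
  by rewrite lt; nra.
(* Since [k < n], [ln t = (k + 1) ln n] is at most [n ln n]. *)
have llt : ln (ln t) <= (1 + e) ^+ 2 * ln n%:R.
  apply: (@le_trans _ _ (ln (n%:R * ln n%:R))).
    have p1 : 0 < ln t by exact: lt_le_trans lt1.
    have p2 : 0 < n%:R * ln n%:R :> R by rewrite mulr_gt0.
    rewrite ler_ln ?posrE//.
    by rewrite lt ler_pM2r// ler_nat.
  rewrite lnM ?posrE//; set y := ln n%:R in yn y1 y0 *.
  have : ln y <= 2 * e * y.
    rewrite -[leRHS]expRK ler_ln ?posrE ?expR_gt0//.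
    have := @expR_ge1Dxn R (2 * e * y) 1 _; rewrite !mulr_ge0 ?(ltW e0) ?(ltW y0)// => /(_ isT).
    apply: le_trans; rewrite -[2`!]/2%N.
    have : 1 <= e ^+ 2 * y.
      by rewrite -ler_pdivrMl ?exprn_gt0// mulr1; lra.
    by have := y0; nra.
  by have : 0 <= e ^+ 2 * y by [rewrite mulr_ge0 ?sqr_ge0// ltW]; nra.
have V0 := heat_cov_gt0 R t t0.
have lil : lil_norm R t <= (1 + e) * (Num.sqrt (2 * ln n%:R) * Num.sqrt (heat_cov R t t)).
  have p1 : 0 <= Num.sqrt (2 * ln n%:R) * Num.sqrt (heat_cov R t t) by rewrite mulr_ge0 ?sqrtr_ge0.
  have p2 : 0 <= lil_norm R t by rewrite mulr_ge0 ?powR_ge0 ?sqrtr_ge0.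
  rewrite -(@ler_pXn2r _ 2)// ?nnegrE ?mulr_ge0 ?addr_ge0 ?(ltW e0)//.
  rewrite (lil_norm_sqr _ _ t0 (ln_ge0 lt1)) exprMn [(_ * Num.sqrt _) ^+ 2]exprMn.
  rewrite !sqr_sqrtr ?(ltW V0)//; last by rewrite mulr_ge0// ltW.
  rewrite [leRHS](_ : _ = 2 * heat_cov R t t * ((1 + e) ^+ 2 * ln n%:R)); last by ring.
  by rewrite ler_pM2l// mulr_gt0.
rewrite -mulrA; set Q := Num.sqrt _ * _ in lil *.
have Q0 : 0 <= Q by rewrite mulr_ge0 ?sqrtr_ge0.
have : (1 - 4 * e) * lil_norm R t <= (1 - 4 * e) * ((1 + e) * Q) by rewrite ler_wpM2l//; lra.
by have : 0 <= e ^+ 2 * Q by [rewrite mulr_ge0 ?sqr_ge0]; nra.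
Qed.

End lower_bound.

(** * The limit superior *)

Section lil_ratio.
Context (R : realType).

Lemma near_lil_norm_gt0 : \forall t \near +oo, 1 < t /\ 0 < lil_norm R t.
Proof.
exists (expR (expR 1)); split; first exact: num_real.
move=> t ht; have t0 : 0 < t by apply: lt_trans ht; exact: expR_gt0.
have e1 : 1 < expR 1 :> R by rewrite expR_gt1.
have t1 : expR 1 < ln t by rewrite -[ltLHS]expRK ltr_ln ?posrE ?expR_gt0.
split; first by apply: lt_trans ht; rewrite expR_gt1 expR_gt0.
by apply: lil_norm_gt0 => //; rewrite ln_gt0// (lt_trans e1).
Qed.

(** Tolerances indexed by [m] allow countably many almost sure statements to hold on one event;
    [m + 5] keeps the lower tolerance below [4^-1]. *)
Lemma limf_esup_lil_ratio (f : R -> R) :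
  (forall m : nat, \forall t \near +oo, f t <= (1 + 2 * m.+1%:R^-1) * lil_norm R t) ->
  (forall (m : nat) (T : R), exists2 t, T < t &
     (1 - 4 * (m + 5)%:R^-1) * lil_norm R t < f t) ->
  limf_esup (fun t => (f t / lil_norm R t)%:E) (pinfty_nbhs R) = 1%E.
Proof.
move=> up lo; rewrite limf_esupE; apply/eqP; rewrite eq_le; apply/andP; split.
- apply/lee_addgt0Pr => e e0; pose m := Num.truncn (2 / e).
  have me : 2 * m.+1%:R^-1 <= e.
    by rewrite ler_pdivrMr ?ltr0n// mulrC -ler_pdivrMr// ltW// truncnS_gt.
  pose V := [set t | f t / lil_norm R t <= 1 + e].
  apply: (@le_trans _ _ (ereal_sup [set (f t / lil_norm R t)%:E | t in V])).
    apply: ereal_inf_lbound; exists V => //.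
    have := near_lil_norm_gt0; have := up m; apply: filterS2 => t ft [_ N0].
    rewrite /V/= ler_pdivrMr// (le_trans ft)// ler_pM2r// lerD2l//.
  by apply: ge_ereal_sup => _ [t Vt <-]; rewrite lee_fin.
- apply: le_ereal_inf_tmp => _ [V FV <-].
  apply/lee_subgt0Pr => e e0; pose m := Num.truncn (4 / e).
  have me : 4 * (m + 5)%:R^-1 <= e.
    rewrite ler_pdivrMr ?ltr0n ?addn_gt0 ?orbT// mulrC -ler_pdivrMr// ltW//.
    by apply: (lt_le_trans (truncnS_gt _)); rewrite ler_nat -addn1 leq_add2l.
  have [T [_ HT]] : \forall t \near +oo, V t /\ (1 < t /\ 0 < lil_norm R t).
    by apply: filterI => //; exact: near_lil_norm_gt0.
  have [t Tt ft] := lo m T; have [Vt [_ N0]] := HT t Tt.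
  apply: (@le_trans _ _ (f t / lil_norm R t)%:E); last by apply: ereal_sup_ubound; exists t.
  rewrite -EFinB lee_fin ler_pdivlMr// (le_trans _ (ltW ft))// ler_pM2r// lerD2l lerN2//.
Qed.

(** The fourth power clears both roots, leaving [(2 t / pi) (ln (ln t))^2], with [2 <= pi] and
    [ln (ln t) <= t]. *)
Lemma lil_norm_pow4_le (t : R) : 1 < t -> 0 < lil_norm R t -> lil_norm R t ^+ 4 <= t ^+ 3.
Proof.
move=> t1 N0; have t0 : 0 < t by exact: lt_trans t1.
have p1 : 2 <= pi :> R by exact: pi_ge2.
have p0 : 0 < pi :> R by exact: pi_gt0.
have tp0 : 0 <= 2 * t / pi by rewrite divr_ge0 ?mulr_ge0// ltW.
(* A negative iterated logarithm would make the square root, hence [lil_norm R t], vanish. *)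
have l0 : 0 <= ln (ln t).
  rewrite leNgt; apply/negP => l0; move: N0.
  by rewrite /lil_norm (ler0_sqrtr (ltW l0)) mulr0 ltxx.
have lt0 : 0 < ln t by rewrite ln_gt0.
have ll : ln (ln t) <= t.
  have h (u : R) : 0 < u -> ln u <= u.
    by move=> u0; rewrite -[leRHS]expRK ler_ln ?posrE ?expR_gt0// (le_trans _ (expR_ge1Dx u))// lerDr.
  exact: le_trans (h _ lt0) (h _ t0).
rewrite /lil_norm exprMn.
rewrite -[(_ `^ _) ^+ 4]powR_mulrn ?powR_ge0// -powRrM mulVf ?powRr1//.
rewrite (_ : Num.sqrt _ ^+ 4 = ln (ln t) ^+ 2); last first.
  by rewrite (exprM _ 2 2) sqr_sqrtr.
rewrite [t ^+ 3]exprS; apply: ler_pM => //; first by rewrite sqr_ge0.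
- by rewrite ler_pdivrMr// mulrC ler_pM2l.
- by rewrite lerXn2r ?nnegrE// ltW.
Qed.

(** Compared at the fourth power: [c^4 t^3 < (e t)^4] once [t > c^4 / e^4]. *)
Lemma cvg_lil_ratio0 (f : R -> R) (c : R) : 0 < c ->
  (\forall t \near +oo, f t <= c * lil_norm R t) ->
  (\forall t \near +oo, - f t <= c * lil_norm R t) ->
  f t / t @[t --> +oo] --> 0.
Proof.
move=> c0 up lo; apply/cvgr0Pnorm_lt => e e0.
have T : \forall t \near +oo, c ^+ 4 / e ^+ 4 < t.
  by apply: nbhs_pinfty_gt; exact: num_real.
have UL : \forall t \near +oo, f t <= c * lil_norm R t /\ - f t <= c * lil_norm R t.
  exact: filterI up lo.
have := near_lil_norm_gt0; move: UL T; apply: filterS3 => t [ft fNt] tT [t1 N0].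
have t0 : 0 < t by exact: lt_trans t1.
rewrite normrM normfV (gtr0_norm t0) ltr_pdivrMr//.
have fle : `|f t| <= c * lil_norm R t by rewrite ler_norml lerNl fNt ft.
apply: le_lt_trans fle _.
have cN0 : 0 <= c * lil_norm R t by exact: mulr_ge0 (ltW c0) (ltW N0).
have et0 : 0 <= e * t by exact: mulr_ge0 (ltW e0) (ltW t0).
rewrite -(@ltr_pXn2r _ 4)//.
rewrite [ltLHS]exprMn [ltRHS]exprMn; apply: (@le_lt_trans _ _ (c ^+ 4 * t ^+ 3)).
  by rewrite ler_pM2l ?exprn_gt0// lil_norm_pow4_le.
rewrite [t ^+ 4]exprS [ltRHS]mulrA ltr_pM2r ?exprn_gt0//.
by rewrite mulrC -ltr_pdivrMr ?exprn_gt0.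
Qed.

End lil_ratio.

Theorem theorem2 (R : realType) (d : measure_display)
    (Omega : measurableType d) (P : probability Omega R)
    (L : set (space_time (R := R)) -> {RV P >-> R}) (hL : white_noise L)
    (Y : R -> R -> {RV P >-> R}) (hY : mild_solution L Y)
    (Y0 : R -> {RV P >-> R})
    (hY0 : continuous_version (fun t => Y t 0) Y0) :
  {ae P, forall w,
    let q := fun t : R =>
      (Y0 t w / ((2 * t / pi) `^ (4^-1) * Num.sqrt (ln (ln t))))%:E in
    limf_esup q (pinfty_nbhs R) = 1%E /\
    (- limf_einf q (pinfty_nbhs R) = 1)%E} /\
  {ae P, forall w, Y0 t w / t @[t --> +oo] --> 0}.
Proof.
have [YE cY] := hY0.
have hX : heat_process R d Omega P Y0 by exact: mild_solution_heat_process hL hY YE.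
have hXN := heat_processN R d Omega P Y0 hX.
have cYN : {ae P, forall w, {within `[0, +oo[, continuous (fun t => (- Y0 t) w)}}.
  by move: cY; apply: filterS => w cw t; apply: cvgN; exact: cw.
have e1 (m : nat) : 0 < (m.+1%:R^-1 : R) <= 1.
  by rewrite invr_gt0 ltr0n/= invf_le1 ?ltr0n// ler1n.
have e2 (m : nat) : 0 < ((m + 5)%:R^-1 : R) < 4^-1.
  have m5 : (0 < m + 5)%N by rewrite addn_gt0 orbT.
  by rewrite invr_gt0 ltr0n m5/= ltf_pV2 ?posrE ?ltr0n// ltr_nat addnS ltnS leq_addl.
have up := ae_foralln (fun m => heat_process_limsup_le R d Omega P Y0 hX _ (e1 m) cY).
have upN := ae_foralln (fun m => heat_process_limsup_le R d Omega P _ hXN _ (e1 m) cYN).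
have lo := ae_foralln (fun m => heat_process_limsup_ge R d Omega P Y0 hX _ (e2 m)).
have loN := ae_foralln (fun m => heat_process_limsup_ge R d Omega P _ hXN _ (e2 m)).
split.
- have sup : {ae P, forall w,
      limf_esup (fun t => (Y0 t w / lil_norm R t)%:E) (pinfty_nbhs R) = 1%E}.
    by move: up lo; apply: filterS2 => w; exact: limf_esup_lil_ratio.
  have supN : {ae P, forall w,
      limf_esup (fun t => ((- Y0 t) w / lil_norm R t)%:E) (pinfty_nbhs R) = 1%E}.
    by move: upN loN; apply: filterS2 => w; exact: limf_esup_lil_ratio.
  move: sup supN; apply: filterS2 => w sup supN; split=> //.
  rewrite -limf_esupN -supN; congr limf_esup; apply/funext => t.
  by rewrite /= mulNr.
- move: up upN; apply: filterS2 => w up upN.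
  (* The crude tolerance [m = 0] suffices, since any fixed multiple of the normalisation is
     negligible against [t]. *)
  apply: (@cvg_lil_ratio0 R (Y0 ^~ w) (1 + 2 * 1%:R^-1)).
  + by rewrite addr_gt0// mulr_gt0.
  + exact: (up 0%N).
  + exact: (upN 0%N).
Qed.
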